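(* For all integers $n\ge0$, $m\ge1$ and $k\ge1$, with $N=n+\tfrac34$, $$\ln N+\gamma+4\ln2+\sum_{s=1}^{2m}\frac{\beta_{2s}}{N^{2s}}<\pi G_n<\ln N+\gamma+4\ln2+\sum_{s=1}^{2k-1}\frac{\beta_{2s}}{N^{2s}},$$ where $G_n$ is the $n$-th Landau constant, $\gamma$ is Euler's constant, and the numbers $\beta_{2s}$ are those defined recursively in the context.
   Context: Landau constants: $G_0=1$ and, for $n\ge1$, $$G_n=1+\left(\frac12\right)^2+\left(\frac{1\cdot3}{2\cdot4}\right)^2+\cdots+\left(\frac{1\cdot3\cdots(2n-1)}{2\cdot4\cdots(2n)}\right)^2.$$ Euler's constant is $\gamma=0.5772\cdots$. Coefficients $d_{j,s}$: for integers $j\ge1$, $d_{j,j+1}=4j^2$ and, for $s\ge j+2$, $$d_{j,s}=\frac{(2s+2j-2)\,(2s-2)!}{(2s-2j)!\,(2j-1)!}+\frac{(2s-3)!}{8\,(2s-2j-2)!\,(2j-1)!};$$ and for $s\ge2$, $$d_{0,s}=\left(\frac1s-\frac1{2s-1}\right)+\frac1{16(s-1)}.$$ The numbers $\beta_{2k}$ ($k=1,2,\dots$) are defined recursively by $$\beta_{2k}=\frac{-1}{4k^2}\left(\sum_{j=1}^{k-1}d_{j,k+1}\,\beta_{2j}-d_{0,k+1}\right),$$ so e.g. $\beta_2=\frac{11}{192}$, $\beta_4=-\frac{1541}{122880}$. *)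

(* Defs.v *)
(* Stdlib reals with Coquelicot. *)
From Stdlib Require Import Reals Lra Lia Arith.
From Coquelicot Require Import Coquelicot.

Local Open Scope R_scope.

(* (1 * 3 * ... * (2k-1)) / (2 * 4 * ... * (2k)) *)
Fixpoint oddeven_ratio (k : nat) : R :=
  match k with
  | O => 1
  | S i => oddeven_ratio i * ((2 * INR (S i) - 1) / (2 * INR (S i)))
  end.

(* [sum_n a n] is a 0 + ... + a n. *)
Definition landau_G (n : nat) : R := sum_n (fun k => oddeven_ratio k ^ 2) n.

(* Shifting the index to n + 1 avoids [ln 0] and does not change the limit. *)
Definition euler_gamma : R :=
  real (Lim_seq (fun n => sum_n_m (fun k => / INR k) 1 (S n) - ln (INR (S n)))).

(* Meaningful for j = 0, s >= 2 and for j >= 1, s >= j + 1 only; there every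
   subtraction on [nat] below is exact. *)
Definition d (j s : nat) : R :=
  if (j =? 0)%nat then
    (1 / INR s - 1 / (2 * INR s - 1)) + 1 / (16 * (INR s - 1))
  else if (s =? j + 1)%nat then 4 * INR j ^ 2
  else
    INR (2 * s + 2 * j - 2) * INR (fact (2 * s - 2))
      / (INR (fact (2 * s - 2 * j)) * INR (fact (2 * j - 1)))
    + INR (fact (2 * s - 3))
      / (8 * INR (fact (2 * s - 2 * j - 2)) * INR (fact (2 * j - 1))).

(* [beta_upto n] is the table of the values with index 1, ..., n; it encodes
   the course-of-values recursion made explicit in [beta_rec]. [sum_n_m a 1 i]
   is 0 when i = 0. *)
Fixpoint beta_upto (n : nat) : nat -> R :=
  match n with
  | O => fun _ => 0
  | S i => fun k =>
      if (k =? S i)%nat then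
        - 1 / (4 * INR k ^ 2)
          * (sum_n_m (fun j => d j (k + 1) * beta_upto i j) 1 i - d 0 (k + 1))
      else beta_upto i k
  end.

(* [beta s] is the number written with index 2s. *)
Definition beta (s : nat) : R := beta_upto s s.

Lemma beta_upto_stable (n k : nat) : (k <= n)%nat -> beta_upto n k = beta k.
Proof.
induction n as [|n IH]; intros Hk.
- now replace k with 0%nat by lia.
- destruct (Nat.eq_dec k (S n)) as [->|Hne]; [reflexivity|].
  cbn [beta_upto]. rewrite (proj2 (Nat.eqb_neq _ _) Hne). apply IH; lia.
Qed.

Lemma beta_rec (k : nat) : (1 <= k)%nat ->
  beta k = - 1 / (4 * INR k ^ 2)
           * (sum_n_m (fun j => d j (k + 1) * beta j) 1 (k - 1) - d 0 (k + 1)).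
Proof.
destruct k as [|i]; [lia|]; intros _.
unfold beta at 1; cbn [beta_upto]. rewrite Nat.eqb_refl.
replace (S i - 1)%nat with i by lia.
do 2 f_equal. apply sum_n_m_ext_loc; intros j Hj.
now rewrite beta_upto_stable by lia.
Qed.

(* Main.v *)
Require Import Defs.
From Stdlib Require Import Reals Lra Lia Arith.
From Coquelicot Require Import Coquelicot.

(** Put N = n + 3/4, and let S_m(N) be ln N plus the first m correction terms.
    The recursion of the squared ratios says that pi G_n is annihilated by
      L f (N) = (N + 1/4)^2 (f (N + 1) - f N) - (N - 1/4)^2 (f N - f (N - 1)),
    and the [d j s] are the coefficients of L (1 / N^(2j)) and of - L ln in
    powers of 1 / N^2. So L S_m is the series in 1 / N^2 whose coefficients are
    the left sides of the recursion for beta truncated at index m; those up to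
    s = m + 1 vanish. The heart of the proof is that all the later ones have
    the sign of (-1)^(m+1) ([defect_sign], where s = n + 2). Hence for the error
    R_n = pi G_n - S_m(N) - const the quotients (R_(n+1) - R_n) / (G_(n+1) - G_n)
    are monotone in n. Since G_n diverges while R_n tends to 0, these quotients
    have a fixed sign, then R_n is monotone, and so R_n has the sign of (-1)^m
    ([relative_monotone_pos], [expansion_error_sign]).

    For the sign, write f as a Laplace transform: 1 / N^(2j) corresponds to
    t^(2j-1) / (2j-1)!, and L becomes multiplication by sinh (t/2) followed by
    Legendre's operator of degree -1/2 in the variable cosh (t/2). With x = t/2
    the generating function y of the beta is therefore a / sinh x, where the
    power series a solves sinh x a'' + cosh x a' + (sinh x) a / 4 = 0, and one
    has to apply the operator to truncations of y. Two facts on truncations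
    suffice: truncating x / sinh x (respectively x coth x) and multiplying back
    by sinh x / x leaves an error with coefficients of a single sign
    ([csch_trunc_sign], [coth_trunc_sign]). The one for coth gives the signs of
    the coefficients of a and of Legendre's operator on truncations of a
    ([legendre_solution_sign], [legendre_trunc_sign]); the one for 1 / sinh
    passes from a to y ([legendre_sinh_trunc_sign]). Both facts are the slopes
    at the two ends of [0, 1] of functions that are obtained from an explicit
    positive one by solving - f'' = g, f (0) = f (1) = 0 repeatedly, applied to
    the expansion of sinh (x t) / sinh t in powers of t.

    The constant gamma + 4 ln 2 comes from Abel summation: the power series
    with coefficients pi (G_n - G_(n-1)) is twice the complete elliptic integral
    K, and 2 K + ln (1 - x) tends to 4 ln 2 at x = 1; comparing with the
    harmonic series - ln (1 - x) turns this into a statement on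
    pi G_n - (1 + 1/2 + ... + 1/n) ([landau_harmonic_limit]). *)

Local Open Scope R_scope.

(** * Finite sums and convolution of sequences *)

Lemma sum_S (f : nat -> R) (n : nat) :
  sum_f_R0 f (S n) = sum_f_R0 f n + f (S n).
Proof. reflexivity. Qed.

Lemma sum_split_first (f : nat -> R) (n : nat) :
  sum_f_R0 f (S n) = f 0%nat + sum_f_R0 (fun i => f (S i)) n.
Proof.
induction n as [|n IH]; [reflexivity|].
rewrite sum_S, IH, (sum_S (fun i => f (S i))). lra.
Qed.

Lemma sum_ext (f g : nat -> R) (n : nat) :
  (forall i, (i <= n)%nat -> f i = g i) -> sum_f_R0 f n = sum_f_R0 g n.
Proof. apply sum_eq. Qed.

Lemma sum_add (f g : nat -> R) (n : nat) :
  sum_f_R0 (fun i => f i + g i) n = sum_f_R0 f n + sum_f_R0 g n.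
Proof. apply plus_sum. Qed.

Lemma sum_mull (c : R) (f : nat -> R) (n : nat) :
  sum_f_R0 (fun i => c * f i) n = c * sum_f_R0 f n.
Proof. rewrite scal_sum. apply sum_ext; intros; ring. Qed.

Lemma sum_zero (f : nat -> R) (n : nat) :
  (forall i, (i <= n)%nat -> f i = 0) -> sum_f_R0 f n = 0.
Proof.
intros H. rewrite (sum_ext f (fun _ => 0) n H).
induction n as [|n IH]; simpl; [reflexivity|].
rewrite IH; [lra|]. intros; apply H; lia.
Qed.

Lemma sum_nonneg (f : nat -> R) (n : nat) :
  (forall i, (i <= n)%nat -> 0 <= f i) -> 0 <= sum_f_R0 f n.
Proof.
intros H. induction n as [|n IH]; simpl; [apply H; lia|].
apply Rplus_le_le_0_compat; [apply IH; intros|]; apply H; lia.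
Qed.

Lemma sum_rev (f : nat -> R) (n : nat) :
  sum_f_R0 (fun i => f (n - i)%nat) n = sum_f_R0 f n.
Proof.
induction n as [|n IH]; [reflexivity|].
rewrite sum_split_first, sum_S, <- IH.
rewrite Nat.sub_0_r, Rplus_comm. f_equal.
Qed.

Lemma sum_pairs (f : nat -> R) (n : nat) :
  sum_f_R0 f (2 * n + 1)
  = sum_f_R0 (fun i => f (2 * i)%nat + f (2 * i + 1)%nat) n.
Proof.
induction n as [|n IH]; [reflexivity|].
replace (2 * S n + 1)%nat with (S (S (2 * n + 1))) by lia.
rewrite !sum_S, IH. rewrite Rplus_assoc. do 2 f_equal; f_equal; lia.
Qed.

Lemma sum_single (f : nat -> R) (k n : nat) :
  (forall j, j <> k -> f j = 0) ->
  sum_f_R0 f n = if (n <? k)%nat then 0 else f k.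
Proof.
intros H. induction n as [|n IH].
- destruct k; [reflexivity|]. apply H. lia.
- rewrite sum_S, IH.
  destruct (Nat.ltb_spec n k), (Nat.ltb_spec (S n) k); try lia.
  + rewrite H by lia. ring.
  + replace (S n) with k by lia. ring.
  + rewrite (H (S n)) by lia. ring.
Qed.

Lemma sum_triangle (f : nat -> nat -> R) (n : nat) :
  sum_f_R0 (fun i => sum_f_R0 (f i) (n - i)) n
  = sum_f_R0 (fun k => sum_f_R0 (fun i => f i (k - i)%nat) k) n.
Proof.
induction n as [|n IH]; [reflexivity|].
rewrite (sum_S _ n), Nat.sub_diag.
rewrite (sum_ext _ (fun i => sum_f_R0 (f i) (n - i) + f i (S n - i)%nat)).
2:{ intros i Hi. replace (S n - i)%nat with (S (n - i)) by lia. reflexivity. }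
rewrite sum_add, IH, (sum_S _ n), (sum_S (fun i => f i (S n - i)%nat)), Nat.sub_diag.
simpl. lra.
Qed.

(** A sequence stands for a formal power series, and [conv] for the product of
    two of them. *)
Definition conv (a b : nat -> R) (n : nat) : R :=
  sum_f_R0 (fun i => a i * b (n - i)%nat) n.

Lemma conv_ext (a a' b b' : nat -> R) (n : nat) :
  (forall i, (i <= n)%nat -> a i = a' i) -> (forall i, (i <= n)%nat -> b i = b' i) ->
  conv a b n = conv a' b' n.
Proof. intros Ha Hb. apply sum_ext; intros i Hi. rewrite Ha, Hb by lia; reflexivity. Qed.

Lemma conv_comm (a b : nat -> R) (n : nat) : conv a b n = conv b a n.
Proof.
unfold conv. rewrite <- sum_rev. apply sum_ext; intros i Hi.
replace (n - (n - i))%nat with i by lia. ring.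
Qed.

Lemma conv_assoc (a b c : nat -> R) (n : nat) :
  conv (conv a b) c n = conv a (conv b c) n.
Proof.
transitivity (sum_f_R0 (fun k => sum_f_R0
   (fun i => a i * b (k - i)%nat * c (n - i - (k - i))%nat) k) n).
- apply sum_ext; intros k Hk. unfold conv.
  rewrite Rmult_comm, <- sum_mull. apply sum_ext; intros i Hi.
  replace (n - i - (k - i))%nat with (n - k)%nat by lia. ring.
- rewrite <- (sum_triangle (fun i j => a i * b j * c (n - i - j)%nat)).
  apply sum_ext; intros i Hi. unfold conv. rewrite <- sum_mull.
  apply sum_ext; intros; ring.
Qed.

Lemma conv_add_l (a a' b : nat -> R) (n : nat) :
  conv (fun i => a i + a' i) b n = conv a b n + conv a' b n.
Proof. unfold conv. rewrite <- sum_add. apply sum_ext; intros; ring. Qed.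

Lemma conv_mull_l (c : R) (a b : nat -> R) (n : nat) :
  conv (fun i => c * a i) b n = c * conv a b n.
Proof. unfold conv. rewrite <- sum_mull. apply sum_ext; intros; ring. Qed.

(** The operator x d/dx on formal power series. *)
Definition theta (a : nat -> R) (n : nat) : R := INR n * a n.

Lemma theta_conv (a b : nat -> R) (n : nat) :
  theta (conv a b) n = conv (theta a) b n + conv a (theta b) n.
Proof.
unfold theta, conv. rewrite <- sum_add, <- sum_mull. apply sum_ext; intros i Hi.
rewrite minus_INR by lia. ring.
Qed.

Definition trunc (m : nat) (a : nat -> R) (n : nat) : R :=
  if (n <=? m)%nat then a n else 0.

Lemma trunc_le (m n : nat) (a : nat -> R) : (n <= m)%nat -> trunc m a n = a n.
Proof. intros H. unfold trunc. now rewrite (proj2 (Nat.leb_le _ _) H). Qed.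

Lemma trunc_gt (m n : nat) (a : nat -> R) : (m < n)%nat -> trunc m a n = 0.
Proof. intros H. unfold trunc. now rewrite (proj2 (Nat.leb_gt _ _) H). Qed.

Lemma conv_trunc_l (m n : nat) (a b : nat -> R) : (m <= n)%nat ->
  conv (trunc m a) b n = sum_f_R0 (fun i => a i * b (n - i)%nat) m.
Proof.
intros H. unfold conv. induction n as [|n IH] in H, b |- *.
- replace m with 0%nat by lia. simpl. now rewrite trunc_le.
- destruct (Nat.eq_dec m (S n)) as [->|Hne].
  + apply sum_ext; intros i Hi. now rewrite trunc_le.
  + rewrite sum_S, trunc_gt by lia.
    rewrite (sum_ext _ (fun i => trunc m a i * (fun k => b (S k)) (n - i)%nat)).
    2:{ intros i Hi. f_equal. f_equal. lia. }
    rewrite (IH (fun k => b (S k))) by lia. rewrite Rmult_0_l, Rplus_0_r.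
    apply sum_ext; intros i Hi. do 2 f_equal. lia.
Qed.

(** Regroups the truncation of a product of series by the index of the first
    factor, so that what is left of the second factor is again a truncation. *)
Lemma conv_trunc_conv (m n : nat) (a g b : nat -> R) : (m <= n)%nat ->
  conv (trunc m (conv a g)) b n
  = sum_f_R0 (fun l => a l * conv (trunc (m - l) g) b (n - l)) m.
Proof.
intros H. rewrite conv_trunc_l by exact H.
transitivity (sum_f_R0 (fun k => sum_f_R0
   (fun i => a i * g (k - i)%nat * b (n - i - (k - i))%nat) k) m).
- apply sum_ext; intros k Hk. unfold conv.
  rewrite Rmult_comm, <- sum_mull. apply sum_ext; intros i Hi.
  replace (n - i - (k - i))%nat with (n - k)%nat by lia. ring.
- rewrite <- (sum_triangle (fun i j => a i * g j * b (n - i - j)%nat)).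
  apply sum_ext; intros i Hi. rewrite conv_trunc_l by lia. rewrite <- sum_mull.
  apply sum_ext; intros; ring.
Qed.

(** * Truncations of x / sinh x and x coth x *)

Definition primitive (f : R -> R) (x : R) : R := RInt f 0 x.

Lemma primitive_derive (f : R -> R) : (forall x, continuous f x) ->
  forall x, is_derive (primitive f) x (f x).
Proof.
intros Hf x. apply (is_derive_RInt f (primitive f) 0 x); [|apply Hf].
apply filter_forall; intros b. apply (@RInt_correct R_CompleteNormedModule).
apply (@ex_RInt_continuous R_CompleteNormedModule); auto.
Qed.

Lemma primitive_0 (f : R -> R) : primitive f 0 = 0.
Proof. apply (RInt_point (V := R_CompleteNormedModule)). Qed.

(** The solution of v'' = - f which vanishes at 0 and at 1. *)
Definition dirichlet (f : R -> R) (x : R) : R :=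
  x * primitive (primitive f) 1 - primitive (primitive f) x.

Definition dirichlet_deriv (f : R -> R) (x : R) : R :=
  primitive (primitive f) 1 - primitive f x.

Lemma derive_continuous (f : R -> R) (x l : R) : is_derive f x l -> continuous f x.
Proof. intros H. apply (ex_derive_continuous (V := R_NormedModule)). now exists l. Qed.

Lemma dirichlet_derive (f : R -> R) (x : R) : (forall y, continuous f y) ->
  is_derive (dirichlet f) x (dirichlet_deriv f x).
Proof.
intros Hf.
assert (H1 := primitive_derive f Hf).
assert (H2 := primitive_derive (primitive f)
   (fun y => derive_continuous _ _ _ (H1 y)) x).
unfold dirichlet, dirichlet_deriv. auto_derive.
- now exists (primitive f x).
- change (fun x0 => primitive (primitive f) x0) with (primitive (primitive f)).
  rewrite (is_derive_unique _ _ _ H2). ring.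
Qed.

Lemma dirichlet_deriv_derive (f : R -> R) (x : R) : (forall y, continuous f y) ->
  is_derive (dirichlet_deriv f) x (- f x).
Proof.
intros Hf. assert (H1 := primitive_derive f Hf x).
unfold dirichlet_deriv. auto_derive.
- now exists (f x).
- change (fun x0 => primitive f x0) with (primitive f).
  rewrite (is_derive_unique _ _ _ H1). ring.
Qed.

(** The coefficients in sinh (x t) / sinh t = sum_p (-1)^p (lidstone p x) t^(2p).
    Comparing both sides of (d/dx)^2 = t^2 gives the recursion. *)
Fixpoint lidstone (p : nat) : R -> R :=
  match p with
  | O => fun x => x
  | S q => dirichlet (lidstone q)
  end.

Definition lidstone_deriv (p : nat) : R -> R :=
  match p with
  | O => fun _ => 1
  | S q => dirichlet_deriv (lidstone q)
  end.

Lemma lidstone_continuous (p : nat) (x : R) : continuous (lidstone p) x.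
Proof.
revert x; induction p as [|p IH]; intros x.
- apply continuous_id.
- exact (derive_continuous _ _ _ (dirichlet_derive _ x IH)).
Qed.

Lemma lidstone_derive (p : nat) (x : R) :
  is_derive (lidstone p) x (lidstone_deriv p x).
Proof.
destruct p as [|p].
- apply (is_derive_id x).
- apply dirichlet_derive, lidstone_continuous.
Qed.

Lemma lidstone_0 (p : nat) : lidstone p 0 = 0.
Proof.
destruct p; simpl; [reflexivity|].
unfold dirichlet. rewrite primitive_0. ring.
Qed.

Lemma lidstone_1 (p : nat) : lidstone (S p) 1 = 0.
Proof. simpl. unfold dirichlet. ring. Qed.

(** A concave function that vanishes at both ends of an interval lies above
    the chord, so it rises at the left end and falls at the right end. *)
Lemma concave_dirichlet (F F' G : R -> R) :
  (forall x, is_derive F x (F' x)) -> (forall x, is_derive F' x (- G x)) ->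
  (forall x, 0 <= x <= 1 -> 0 <= G x) -> F 0 = 0 -> F 1 = 0 ->
  (forall x, 0 <= x <= 1 -> 0 <= F x) /\ 0 <= F' 0 /\ F' 1 <= 0.
Proof.
intros HF HF' HG F0 F1.
assert (mvt : forall f f' a b, a <= b -> (forall x, is_derive f x (f' x)) ->
   exists c, a <= c <= b /\ f b - f a = f' c * (b - a)).
{ intros f f' a b Hab Hf.
  destruct (MVT_gen f a b f') as [c Hc].
  - intros; apply Hf.
  - intros x _. apply continuity_pt_filterlim. exact (derive_continuous _ _ _ (Hf x)).
  - rewrite Rmin_left, Rmax_right in Hc by lra. now exists c. }
assert (dec : forall a b, 0 <= a -> a <= b -> b <= 1 -> F' b <= F' a).
{ intros a b Ha Hab Hb.
  destruct (mvt F' (fun x => - G x) a b Hab HF') as [c [Hc E]].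
  assert (0 <= G c) by (apply HG; lra). nra. }
destruct (mvt F F' 0 1) as [c [Hc E]]; [lra|exact HF|].
assert (Fc : F' c = 0) by nra.
repeat split.
- intros x Hx. destruct (Rle_lt_dec x c) as [Hxc|Hxc].
  + destruct (mvt F F' 0 x) as [e [He Ee]]; [lra|exact HF|].
    assert (F' c <= F' e) by (apply dec; lra). nra.
  + destruct (mvt F F' x 1) as [e [He Ee]]; [lra|exact HF|].
    assert (F' e <= F' c) by (apply dec; lra). nra.
- assert (F' c <= F' 0) by (apply dec; lra). lra.
- assert (F' 1 <= F' c) by (apply dec; lra). lra.
Qed.

Lemma lidstone_nonneg (p : nat) (x : R) : 0 <= x <= 1 -> 0 <= lidstone p x.
Proof.
revert x; induction p as [|p IH]; [simpl; intros; lra|].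
apply (concave_dirichlet _ (dirichlet_deriv (lidstone p)) (lidstone p)); auto.
- intros; apply (lidstone_derive (S p)).
- intros; apply dirichlet_deriv_derive, lidstone_continuous.
- apply (lidstone_0 (S p)).
- apply lidstone_1.
Qed.

Lemma lidstone_deriv_1_neg (p : nat) : lidstone_deriv (S p) 1 <= 0.
Proof.
apply (concave_dirichlet (lidstone (S p)) (lidstone_deriv (S p)) (lidstone p)).
- intros; apply (lidstone_derive (S p)).
- intros; apply dirichlet_deriv_derive, lidstone_continuous.
- intros; now apply lidstone_nonneg.
- apply lidstone_0.
- apply lidstone_1.
Qed.

(** sinh x / x and cosh x as power series in x^2. *)
Definition sinh_coef (q : nat) : R := / INR (fact (2 * q + 1)).
Definition cosh_coef (q : nat) : R := / INR (fact (2 * q)).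

(** x / sinh x and x coth x as power series in x^2: the derivatives of
    sinh (x t) / sinh t with respect to x at x = 0 and x = 1. *)
Definition csch_coef (i : nat) : R := (-1) ^ i * lidstone_deriv i 0.
Definition coth_coef (i : nat) : R := (-1) ^ i * lidstone_deriv i 1.

Lemma sinh_coef_pos (q : nat) : 0 < sinh_coef q.
Proof. apply Rinv_0_lt_compat, INR_fact_lt_0. Qed.

Lemma cosh_sinh_coef (q : nat) : cosh_coef q = (2 * INR q + 1) * sinh_coef q.
Proof.
unfold cosh_coef, sinh_coef.
replace (2 * q + 1)%nat with (S (2 * q)) by lia.
change (fact (S (2 * q))) with (S (2 * q) * fact (2 * q))%nat.
rewrite mult_INR, S_INR, mult_INR. simpl (INR 2).
field. split; [apply INR_fact_neq_0|]. pose proof (pos_INR q). lra.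
Qed.

(** Up to sign, the coefficient of t^(2l) in
    sinh (x t) / t - (sinh t / t) * sum_{i <= p} (-1)^i (lidstone i x) t^(2i). *)
Definition remainder (p l : nat) (x : R) : R :=
  (-1) ^ S p * (x ^ (2 * l + 1) * sinh_coef l
   - sum_f_R0 (fun i => (-1) ^ i * lidstone i x * sinh_coef (l - i)) p).

Definition remainder_deriv (p l : nat) (x : R) : R :=
  (-1) ^ S p * (x ^ (2 * l) * cosh_coef l
   - sum_f_R0 (fun i => (-1) ^ i * lidstone_deriv i x * sinh_coef (l - i)) p).

Lemma sum_derive (f f' : nat -> R -> R) (x : R) (n : nat) :
  (forall i, is_derive (f i) x (f' i x)) ->
  is_derive (fun y => sum_f_R0 (fun i => f i y) n) x (sum_f_R0 (fun i => f' i x) n).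
Proof.
intros H. induction n as [|n IH]; simpl; [apply H|].
apply (is_derive_plus (V := R_NormedModule)); auto.
Qed.

Lemma remainder_derive (p l : nat) (x : R) :
  is_derive (remainder p l) x (remainder_deriv p l x).
Proof.
unfold remainder, remainder_deriv.
apply (is_derive_scal (fun x => x ^ (2 * l + 1) * sinh_coef l
   - sum_f_R0 (fun i => (-1) ^ i * lidstone i x * sinh_coef (l - i)) p)).
apply (is_derive_minus (V := R_NormedModule)
  (fun x => x ^ (2 * l + 1) * sinh_coef l)
  (fun x => sum_f_R0 (fun i => (-1) ^ i * lidstone i x * sinh_coef (l - i)) p)).
- auto_derive; [exact I|].
  replace (Init.Nat.pred (l + (l + 0) + 1)) with (2 * l)%nat by lia.
  rewrite cosh_sinh_coef, plus_INR, plus_INR, plus_INR. simpl. ring.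
- apply (sum_derive (fun i x => (-1) ^ i * lidstone i x * sinh_coef (l - i))
    (fun i x => (-1) ^ i * lidstone_deriv i x * sinh_coef (l - i))).
  intros i. assert (H := lidstone_derive i x). auto_derive.
  + now exists (lidstone_deriv i x).
  + change (fun x => lidstone i x) with (lidstone i).
    rewrite (is_derive_unique _ _ _ H). ring.
Qed.

Lemma remainder_deriv_derive (p l : nat) (x : R) : 
  is_derive (remainder_deriv (S p) (S l)) x (- remainder p l x).
Proof.
unfold remainder, remainder_deriv.
set (g := fun i => match i with O => fun _ => 0
                   | S j => fun y => (-1) ^ j * lidstone j y * sinh_coef (l - j) end).
replace (- _) with ((-1) ^ S (S p) * (x ^ (2 * l + 1) * sinh_coef l
   - sum_f_R0 (fun i => g i x) (S p))).
2:{ rewrite sum_split_first. simpl. ring. }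
apply (is_derive_scal (fun x => x ^ (2 * S l) * cosh_coef (S l)
   - sum_f_R0 (fun i => (-1) ^ i * lidstone_deriv i x * sinh_coef (S l - i)) (S p))).
apply (is_derive_minus (V := R_NormedModule)
  (fun x => x ^ (2 * S l) * cosh_coef (S l))
  (fun x => sum_f_R0
     (fun i => (-1) ^ i * lidstone_deriv i x * sinh_coef (S l - i)) (S p))).
- replace (2 * S l)%nat with (S (2 * l + 1)) by lia.
  unfold cosh_coef, sinh_coef. replace (2 * S l)%nat with (S (2 * l + 1)) by lia.
  change (fact (S (2 * l + 1))) with (S (2 * l + 1) * fact (2 * l + 1))%nat.
  rewrite mult_INR.
  generalize (INR_fact_neq_0 (2 * l + 1)) (not_0_INR (S (2 * l + 1)) ltac:(lia)).
  generalize (INR (fact (2 * l + 1))). intros v Hv Hu.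
  replace (x ^ (2 * l + 1) * / v)
    with (INR (S (2 * l + 1)) * 1 * x ^ (2 * l + 1) * / (INR (S (2 * l + 1)) * v))
    by (field; auto).
  apply (is_derive_ext (fun y => / (INR (S (2 * l + 1)) * v) * y ^ S (2 * l + 1)));
    [intros; apply Rmult_comm|].
  rewrite (Rmult_comm _ (/ _)).
  apply (is_derive_scal (fun y => y ^ S (2 * l + 1))).
  apply (is_derive_pow (fun y => y) (S (2 * l + 1)) x 1), (is_derive_id x).
- apply (sum_derive
    (fun i x => (-1) ^ i * lidstone_deriv i x * sinh_coef (S l - i)) g).
  intros [|i]; simpl.
  + auto_derive; [exact I|ring].
  + assert (H := dirichlet_deriv_derive _ x (lidstone_continuous i)). auto_derive.
    * now exists (- lidstone i x).
    * change (fun x => dirichlet_deriv (lidstone i) x)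
        with (dirichlet_deriv (lidstone i)).
      rewrite (is_derive_unique _ _ _ H). ring.
Qed.

Lemma remainder_ends (p l : nat) : remainder p l 0 = 0 /\ remainder p l 1 = 0.
Proof.
unfold remainder. split.
- rewrite (sum_zero _ p); [|intros; rewrite lidstone_0; ring].
  rewrite pow_i by lia. ring.
- replace (sum_f_R0 _ p) with (sinh_coef l); [rewrite pow1; ring|].
  destruct p as [|p]; [simpl; rewrite Nat.sub_0_r; ring|].
  rewrite sum_split_first, (sum_zero _ p).
  + simpl. rewrite Nat.sub_0_r; ring.
  + intros; rewrite lidstone_1. ring.
Qed.

(** Each remainder solves - f'' = (the previous remainder) with zero boundary
    values, so positivity propagates from the explicit case p = 0. *)
Lemma remainder_nonneg (p l : nat) (x : R) : (p <= l)%nat -> 0 <= x <= 1 ->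
  0 <= remainder p l x.
Proof.
revert l x; induction p as [|p IH]; intros l x Hl Hx.
- unfold remainder. simpl (sum_f_R0 _ _). rewrite Nat.sub_0_r. 
  assert (H : x ^ (2 * l) <= 1).
  { rewrite <- (pow1 (2 * l)). apply pow_incr. lra. }
  pose proof (sinh_coef_pos l). rewrite pow_add, !pow_1.
  assert (0 <= x * (1 - x ^ (2 * l)) * sinh_coef l).
  { repeat apply Rmult_le_pos; lra. }
  simpl in *; nra.
- destruct l as [|l]; [lia|]. revert x Hx.
  apply (concave_dirichlet _ (remainder_deriv (S p) (S l)) (remainder p l)).
  + intros; apply remainder_derive.
  + intros; apply remainder_deriv_derive.
  + intros; apply IH; [lia|auto].
  + apply remainder_ends.
  + apply remainder_ends.
Qed.

Lemma remainder_diag (p : nat) (x : R) : 0 <= x <= 1 -> remainder p p x = 0.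
Proof.
revert x; induction p as [|p IH]; intros x Hx.
- unfold remainder. simpl. ring.
- apply Rle_antisym; [|apply remainder_nonneg; auto].
  assert (0 <= - remainder (S p) (S p) x); [|lra].
  revert x Hx.
  apply (concave_dirichlet (fun x => - remainder (S p) (S p) x)
    (fun x => - remainder_deriv (S p) (S p) x) (fun x => - remainder p p x)).
  + intros; apply (is_derive_opp (V := R_NormedModule)), remainder_derive.
  + intros; apply (is_derive_opp (V := R_NormedModule) (remainder_deriv (S p) (S p))),
      remainder_deriv_derive.
  + intros; rewrite IH; lra.
  + rewrite (proj1 (remainder_ends _ _)); ring.
  + rewrite (proj2 (remainder_ends _ _)); ring.
Qed.

Lemma remainder_slopes (p l : nat) : (p <= l)%nat ->
  0 <= remainder_deriv (S p) (S l) 0 /\ remainder_deriv (S p) (S l) 1 <= 0 /\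
  (p = l -> remainder_deriv (S p) (S l) 0 = 0 /\ remainder_deriv (S p) (S l) 1 = 0).
Proof.
intros Hl.
assert (H : forall s, (forall x, 0 <= x <= 1 -> 0 <= s * remainder p l x) ->
  0 <= s * remainder_deriv (S p) (S l) 0 /\ s * remainder_deriv (S p) (S l) 1 <= 0).
{ intros s Hs.
  apply (concave_dirichlet (fun x => s * remainder (S p) (S l) x)
    (fun x => s * remainder_deriv (S p) (S l) x) (fun x => s * remainder p l x)).
  - intros; apply (is_derive_scal (remainder (S p) (S l))), remainder_derive.
  - intros x. replace (- _) with (s * - remainder p l x) by ring.
    apply (is_derive_scal (remainder_deriv (S p) (S l))), remainder_deriv_derive.
  - exact Hs.
  - rewrite (proj1 (remainder_ends _ _)); ring.
  - rewrite (proj2 (remainder_ends _ _)); ring. }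
destruct (H 1) as [H0 H1].
{ intros; rewrite Rmult_1_l; now apply remainder_nonneg. }
split; [|split]; [lra|lra|].
intros <-. destruct (H (-1)) as [H2 H3]; [|split; lra].
intros x Hx; rewrite remainder_diag by exact Hx; lra.
Qed.

(** The slope at 0 of a [remainder]: positivity on [0, 1] of the truncations of
    sinh (x t) / sinh t passes to the derivative in x at the boundary. *)
Lemma csch_trunc_sign (p l : nat) : (p < l)%nat ->
  0 <= (-1) ^ p * conv (trunc p csch_coef) sinh_coef l.
Proof.
intros Hl. rewrite conv_trunc_l by lia. destruct p as [|p].
- unfold csch_coef; simpl. pose proof (sinh_coef_pos (l - 0)). lra.
- destruct l as [|l]; [lia|].
  destruct (remainder_slopes p l ltac:(lia)) as [H _].
  unfold remainder_deriv in H. rewrite pow_i in H by lia.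
  unfold csch_coef. simpl in *. lra.
Qed.

Lemma csch_sinh (l : nat) :
  conv csch_coef sinh_coef l = if (l =? 0)%nat then 1 else 0.
Proof.
destruct l as [|l].
- unfold conv, csch_coef, sinh_coef. simpl. lra.
- destruct (remainder_slopes l l (le_n l)) as [_ [_ H]].
  destruct (H eq_refl) as [H0 _]. clear H.
  unfold remainder_deriv in H0. rewrite pow_i in H0 by lia.
  rewrite Rmult_0_l in H0. apply Rmult_integral in H0 as [H0|H0].
  + exfalso; revert H0; apply pow_nonzero; lra.
  + change (sum_f_R0 (fun i => csch_coef i * sinh_coef (S l - i)) (S l) = 0).
    unfold csch_coef. lra.
Qed.

(** The slope at 1, where the derivative of sinh (x t) contributes cosh t. *)
Lemma coth_trunc_sign (p l : nat) : (p < l)%nat ->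
  0 <= (-1) ^ p * (cosh_coef l - conv (trunc p coth_coef) sinh_coef l).
Proof.
intros Hl. rewrite conv_trunc_l by lia. destruct p as [|p].
- unfold coth_coef; simpl. rewrite cosh_sinh_coef, Nat.sub_0_r.
  pose proof (sinh_coef_pos l). pose proof (pos_INR l). nra.
- destruct l as [|l]; [lia|].
  destruct (remainder_slopes p l ltac:(lia)) as [_ [H _]].
  unfold remainder_deriv in H. rewrite pow1 in H.
  unfold coth_coef. simpl in *. lra.
Qed.

Lemma coth_sinh (l : nat) : conv coth_coef sinh_coef l = cosh_coef l.
Proof.
destruct l as [|l].
- unfold conv, coth_coef, sinh_coef, cosh_coef. simpl. lra.
- destruct (remainder_slopes l l (le_n l)) as [_ [_ H]].
  destruct (H eq_refl) as [_ H0]. clear H.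
  unfold remainder_deriv in H0. rewrite pow1 in H0.
  apply Rmult_integral in H0 as [H0|H0].
  + exfalso; revert H0; apply pow_nonzero; lra.
  + change (sum_f_R0 (fun i => coth_coef i * sinh_coef (S l - i)) (S l) = cosh_coef (S l)).
    unfold coth_coef. lra.
Qed.

Lemma coth_coef_0 : coth_coef 0 = 1.
Proof. unfold coth_coef; simpl; ring. Qed.

Lemma coth_coef_sign (r : nat) : (-1) ^ S r * coth_coef (S r) <= 0.
Proof.
unfold coth_coef. rewrite <- Rmult_assoc, <- Rpow_mult_distr.
replace (-1 * -1) with 1 by ring. rewrite pow1, Rmult_1_l.
apply lidstone_deriv_1_neg.
Qed.

(** * Formal solutions of Legendre's equation *)

(** For w = sum_i w_i x^(2i), the coefficient of x^(2n+1) in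
    (sinh x w')' + (sinh x) w / 4, which is Legendre's operator of degree -1/2
    in the variable cosh x. *)
Definition legendre (w : nat -> R) (n : nat) : R :=
  4 * INR (S n) * conv (theta w) sinh_coef (S n) + / 4 * conv w sinh_coef n.

Lemma legendre_ext (w w' : nat -> R) (n : nat) :
  (forall i, w i = w' i) -> legendre w n = legendre w' n.
Proof.
intros H. unfold legendre.
rewrite (conv_ext w w' sinh_coef sinh_coef n), 
  (conv_ext (theta w) (theta w') sinh_coef sinh_coef (S n)); auto.
intros i _. unfold theta. now rewrite H.
Qed.

Lemma legendre_add (w w' : nat -> R) (n : nat) :
  legendre (fun i => w i + w' i) n = legendre w n + legendre w' n.
Proof.
unfold legendre. rewrite conv_add_l.
rewrite (conv_ext (theta (fun i => w i + w' i)) (fun i => theta w i + theta w' i)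
  sinh_coef sinh_coef); [|intros; unfold theta; cbv beta; ring|reflexivity].
rewrite conv_add_l. ring.
Qed.

Lemma legendre_nonneg (s : R) (w : nat -> R) (n : nat) :
  (forall i, (i <= S n)%nat -> 0 <= s * w i) -> 0 <= s * legendre w n.
Proof.
intros H.
assert (E : forall a k, (forall i, (i <= k)%nat -> 0 <= s * a i) ->
  0 <= s * conv a sinh_coef k).
{ intros a k Ha. unfold conv. rewrite <- sum_mull. apply sum_nonneg. intros i Hi.
  rewrite <- Rmult_assoc. apply Rmult_le_pos; [now apply Ha|].
  apply Rlt_le, sinh_coef_pos. }
assert (E1 : 0 <= s * conv w sinh_coef n) by (apply E; intros; apply H; lia).
assert (E2 : 0 <= s * conv (theta w) sinh_coef (S n)).
{ apply E. intros i Hi. unfold theta. specialize (H i Hi).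
  pose proof (pos_INR i). nra. }
unfold legendre. pose proof (pos_INR (S n)). nra.
Qed.

(** The coefficient of x^(2j-2) in a'' + coth x a' + a / 4, that is, of
    Legendre's operator divided by sinh x. *)
Definition legendre_coth (a : nat -> R) (j : nat) : R :=
  2 * INR j * (2 * INR j - 1) * a j + 2 * conv (theta a) coth_coef j
  + / 4 * match j with O => 0 | S i => a i end.

Lemma theta_sinh_coef (q : nat) :
  theta sinh_coef q = / 2 * cosh_coef q - / 2 * sinh_coef q.
Proof. unfold theta. rewrite cosh_sinh_coef. field. Qed.

Lemma legendre_sinh_cosh (w : nat -> R) (n : nat) :
  legendre w n =
  conv (fun i => 2 * INR i * (2 * INR i - 1) * w i) sinh_coef (S n)
  + 2 * conv (theta w) cosh_coef (S n) + / 4 * conv w sinh_coef n.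
Proof.
unfold legendre. f_equal.
transitivity (4 * theta (conv (theta w) sinh_coef) (S n));
  [unfold theta at 2; ring|].
rewrite theta_conv. unfold conv. rewrite <- !sum_mull, <- !sum_add, <- sum_mull. apply sum_ext.
intros i Hi. rewrite theta_sinh_coef. unfold theta. field.
Qed.

Lemma conv_shift_l (a b : nat -> R) (n : nat) :
  conv (fun j => match j with O => 0 | S i => a i end) b (S n) = conv a b n.
Proof. unfold conv. rewrite sum_split_first. simpl. ring. Qed.

Lemma legendre_factor (a : nat -> R) (n : nat) :
  legendre a n = conv (legendre_coth a) sinh_coef (S n).
Proof.
rewrite legendre_sinh_cosh, <- (conv_shift_l a).
rewrite (conv_ext (theta a) (theta a) cosh_coef (conv coth_coef sinh_coef));
  [|auto|intros; now rewrite coth_sinh].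
rewrite <- conv_assoc, <- !conv_mull_l, <- !conv_add_l. reflexivity.
Qed.

Lemma legendre_coth_zero (a : nat -> R) : (forall n, legendre a n = 0) ->
  forall j, legendre_coth a j = 0.
Proof.
intros H j. induction j as [j IH] using lt_wf_ind.
destruct j as [|j].
- unfold legendre_coth, conv, theta. simpl. ring.
- specialize (H j). rewrite legendre_factor in H.
  unfold conv in H. rewrite sum_S, Nat.sub_diag in H.
  rewrite sum_zero in H; [|intros i Hi; rewrite IH by lia; ring].
  unfold sinh_coef in H. simpl in H. lra.
Qed.

(** Dividing by sinh x turns Legendre's equation into a recursion whose terms
    all have one sign once the sign (-1)^j is taken out of a j. *)
Lemma legendre_solution_sign (a : nat -> R) : a 0%nat = 1 ->
  (forall n, legendre a n = 0) -> forall j, 0 < (-1) ^ j * a j.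
Proof.
intros H0 H j. induction j as [j IH] using lt_wf_ind.
destruct j as [|n]; [rewrite H0; simpl; lra|].
pose proof (legendre_coth_zero a H (S n)) as E.
unfold legendre_coth, conv in E. rewrite sum_S, Nat.sub_diag, coth_coef_0 in E.
assert (E' : 4 * (INR (S n) * INR (S n)) * ((-1) ^ S n * a (S n)) =
  2 * sum_f_R0 (fun i => INR i * ((-1) ^ i * a i)
     * - ((-1) ^ (S n - i) * coth_coef (S n - i))) n + / 4 * ((-1) ^ n * a n)).
{ rewrite (sum_ext _ (fun i => (- (-1) ^ S n) * (theta a i * coth_coef (S n - i)))).
  - rewrite sum_mull. unfold theta in *. simpl ((-1) ^ S n).
    set (t := sum_f_R0 _ n) in *. revert E. set (z := INR (S n)). intros E.
    replace t with (- / 2 * (2 * z * (2 * z - 1) * a (S n)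
      + 2 * (z * a (S n)) + / 4 * a n)) by lra.
    field.
  - intros i Hi. unfold theta.
    replace ((-1) ^ S n) with ((-1) ^ i * (-1) ^ (S n - i)) by
      (rewrite <- pow_add; f_equal; lia). ring. }
assert (0 <= sum_f_R0 (fun i => INR i * ((-1) ^ i * a i)
     * - ((-1) ^ (S n - i) * coth_coef (S n - i))) n).
{ apply sum_nonneg; intros i Hi.
  apply Rmult_le_pos; [apply Rmult_le_pos; [apply pos_INR|]|].
  - apply Rlt_le, IH; lia.
  - replace (S n - i)%nat with (S (n - i)) by lia.
    pose proof (coth_coef_sign (n - i)). lra. }
pose proof (IH n (Nat.lt_succ_diag_r n)).
assert (0 < INR (S n)) by (apply lt_0_INR; lia).
assert (0 < 4 * (INR (S n) * INR (S n))) by nra.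
apply (Rmult_lt_reg_l (4 * (INR (S n) * INR (S n)))); lra.
Qed.

(** After division by sinh x, the truncated solution fails the equation only by
    the term a m / 4 that the recursion would have passed on to index m + 1, and
    by the truncation errors of coth x; these contributions agree in sign. *)
Lemma legendre_trunc_sign (a : nat -> R) : a 0%nat = 1 ->
  (forall n, legendre a n = 0) ->
  forall m n, (m <= n)%nat -> 0 < (-1) ^ m * legendre (trunc m a) n.
Proof.
intros H0 H m n Hmn.
assert (Hsq : forall i, (-1) ^ i * (-1) ^ i = 1).
{ intros i. rewrite <- Rpow_mult_distr. replace (-1 * -1) with 1 by ring.
  apply pow1. }
set (rho := fun i => cosh_coef (S n - i)
   - conv (trunc (m - i) coth_coef) sinh_coef (S n - i)).
assert (E : legendre (trunc m a) n =
  / 4 * (a m * sinh_coef (n - m)) + 2 * sum_f_R0 (fun i => theta a i * rho i) m).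
{ rewrite legendre_sinh_cosh.
  rewrite (conv_ext (fun i => 2 * INR i * (2 * INR i - 1) * trunc m a i)
    (trunc m (fun i => 2 * INR i * (2 * INR i - 1) * a i)) sinh_coef sinh_coef);
    [|intros; unfold trunc; case (_ <=? _)%nat; ring|auto].
  rewrite (conv_ext (theta (trunc m a)) (trunc m (theta a)) cosh_coef cosh_coef);
    [|intros; unfold theta, trunc; case (_ <=? _)%nat; ring|auto].
  rewrite !conv_trunc_l by lia.
  rewrite (sum_ext (fun i => theta a i * cosh_coef (S n - i))
    (fun i => theta a i * rho i
      + theta a i * conv (trunc (m - i) coth_coef) sinh_coef (S n - i)))
    by (intros; unfold rho; ring).
  rewrite sum_add, <- conv_trunc_conv, conv_trunc_l by lia.
  assert (S1 : sum_f_R0 (fun i => legendre_coth a i * sinh_coef (S n - i)) m = 0).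
  { apply sum_zero; intros. rewrite legendre_coth_zero by exact H. ring. }
  unfold legendre_coth in S1.
  rewrite (sum_ext _ (fun i =>
    (2 * INR i * (2 * INR i - 1) * a i * sinh_coef (S n - i)
    + 2 * (conv (theta a) coth_coef i * sinh_coef (S n - i)))
    + / 4 * (match i with O => 0 | S i => a i end * sinh_coef (S n - i)))) in S1
    by (intros; ring).
  rewrite !sum_add, !sum_mull in S1.
  assert (S2 : sum_f_R0 (fun i => a i * sinh_coef (n - i)) m
    = a m * sinh_coef (n - m) + sum_f_R0 (fun i =>
       match i with O => 0 | S i => a i end * sinh_coef (S n - i)) m).
  { destruct m as [|m]; [simpl; ring|].
    rewrite (sum_S _ m), sum_split_first. simpl. ring. }
  rewrite S2. lra. }
assert (0 <= sum_f_R0 (fun i => (-1) ^ m * (theta a i * rho i)) m).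
{ apply sum_nonneg; intros i Hi. unfold theta.
  replace ((-1) ^ m) with ((-1) ^ i * (-1) ^ (m - i)) by
    (rewrite <- pow_add; f_equal; lia).
  replace (_ * _) with (INR i * ((-1) ^ i * a i) * ((-1) ^ (m - i) * rho i)) by ring.
  apply Rmult_le_pos; [apply Rmult_le_pos; [apply pos_INR|]|].
  - now apply Rlt_le, legendre_solution_sign.
  - apply coth_trunc_sign; lia. }
rewrite sum_mull in H1.
pose proof (legendre_solution_sign a H0 H m).
pose proof (Rmult_lt_0_compat _ _ H2 (sinh_coef_pos (n - m))).
rewrite E. lra.
Qed.

(** With a = y sinh, compare sinh * (truncation of y) with the truncation of a,
    which [legendre_trunc_sign] covers. Their difference starts beyond degree m,
    has the sign of (-1)^m by [csch_trunc_sign], and the coefficients of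
    Legendre's operator are positive. *)
Lemma legendre_sinh_trunc_sign (y : nat -> R) : y 0%nat = 1 ->
  (forall n, legendre (conv y sinh_coef) n = 0) ->
  forall m n, (m <= n)%nat -> 0 < (-1) ^ m * legendre (conv (trunc m y) sinh_coef) n.
Proof.
intros H0 H m n Hmn. set (a := conv y sinh_coef) in *.
assert (unit_r : forall b c k, (forall i, c i = if (i =? 0)%nat then 1 else 0) ->
  conv b c k = b k).
{ intros b c k Hc. rewrite conv_comm. unfold conv. destruct k as [|k].
  - simpl. rewrite Hc. simpl. ring.
  - rewrite sum_split_first, sum_zero, Hc, Nat.sub_0_r; [simpl; ring|].
    intros. rewrite Hc. simpl. ring. }
assert (Hy : forall i, y i = conv a csch_coef i).
{ intros i. unfold a. rewrite conv_assoc, unit_r; [reflexivity|].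
  intros k. rewrite conv_comm. apply csch_sinh. }
assert (A0 : a 0%nat = 1).
{ unfold a, conv, sinh_coef. simpl. lra. }
set (w := fun i => conv (trunc m y) sinh_coef i - trunc m a i).
rewrite (legendre_ext _ (fun i => trunc m a i + w i)) by (intros; unfold w; cbv beta; ring).
rewrite legendre_add, Rmult_plus_distr_l.
apply Rplus_lt_le_0_compat; [now apply legendre_trunc_sign|].
apply legendre_nonneg. intros i Hi. unfold w.
destruct (le_lt_dec i m) as [Him|Him].
- rewrite trunc_le by exact Him.
  rewrite (conv_ext _ y sinh_coef sinh_coef);
    [|intros; apply trunc_le; lia|reflexivity].
  fold a. lra.
- rewrite trunc_gt by exact Him.
  rewrite (conv_ext (trunc m y) (trunc m (conv a csch_coef)) sinh_coef sinh_coef);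
    [|intros; unfold trunc; now rewrite Hy|reflexivity].
  rewrite conv_trunc_conv by lia.
  rewrite Rminus_0_r, <- sum_mull. apply sum_nonneg. intros l Hl.
  replace ((-1) ^ m) with ((-1) ^ l * (-1) ^ (m - l)) by
    (rewrite <- pow_add; f_equal; lia).
  replace (_ * _) with ((-1) ^ l * a l
    * ((-1) ^ (m - l) * conv (trunc (m - l) csch_coef) sinh_coef (i - l))) by ring.
  apply Rmult_le_pos.
  + now apply Rlt_le, legendre_solution_sign.
  + apply csch_trunc_sign; lia.
Qed.

Lemma pascal_binomial (n i : nat) : (i < n)%nat ->
  Binomial.C (S n) (S i) = Binomial.C n i + Binomial.C n (S i).
Proof. intros. symmetry. now apply pascal. Qed.

(** The right side is the coefficient of x^(2k) in (cosh (2 x) - 1) / (2 x^2). *)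
Lemma sinh_sq_coef (k : nat) :
  conv sinh_coef sinh_coef k = 2 ^ (2 * k + 1) / INR (fact (2 * k + 2)).
Proof.
assert (E : sum_f_R0 (fun q => Binomial.C (2 * k + 2) (2 * q + 1)) k = 2 ^ (2 * k + 1)).
{ replace (2 ^ (2 * k + 1)) with ((1 + 1) ^ (2 * k + 1)) by (f_equal; lra).
  rewrite binomial.
  rewrite (sum_ext (fun i => Binomial.C (2 * k + 1) i * 1 ^ i * 1 ^ (2 * k + 1 - i))
    (fun i => Binomial.C (2 * k + 1) i)) by (intros; rewrite !pow1; ring).
  rewrite sum_pairs. apply sum_ext. intros q Hq.
  replace (2 * k + 2)%nat with (S (2 * k + 1)) by lia.
  replace (2 * q + 1)%nat with (S (2 * q)) by lia.
  destruct (Nat.eq_dec q k) as [->|Hne].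
  - replace (2 * k + 1)%nat with (S (2 * k)) by lia.
    unfold Binomial.C. rewrite !Nat.sub_diag.
    replace (S (S (2 * k)) - S (2 * k))%nat with 1%nat by lia.
    replace (S (2 * k) - 2 * k)%nat with 1%nat by lia.
    change (fact (S (S (2 * k)))) with (S (S (2 * k)) * fact (S (2 * k)))%nat.
    change (fact (S (2 * k))) with (S (2 * k) * fact (2 * k))%nat.
    rewrite !mult_INR, !S_INR. simpl (fact 0). simpl (fact 1). simpl (INR 1).
    assert (INR (2 * k) + 1 <> 0) by (pose proof (pos_INR (2 * k)); lra).
    field. split; [apply INR_fact_neq_0|assumption].
  - apply pascal_binomial; lia. }
unfold Rdiv. rewrite <- E, Rmult_comm, <- sum_mull.
apply sum_ext. intros q Hq. unfold sinh_coef, Binomial.C.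
replace (2 * (k - q) + 1)%nat with (2 * k + 2 - (2 * q + 1))%nat by lia.
field. repeat split; apply INR_fact_neq_0.
Qed.

(** The matrix of Legendre's operator in terms of y = w / sinh: since
    theta s * s = theta (s^2) / 2 for s = sinh, only s^2 remains, and index j
    gets the factor j + (S n - j) / 2. *)
Lemma legendre_conv_sinh (y : nat -> R) (n : nat) :
  legendre (conv y sinh_coef) n =
  sum_f_R0 (fun j => y j * (2 * INR (S n) * INR (S n + j)
    * conv sinh_coef sinh_coef (S n - j))) (S n)
  + / 4 * conv y (conv sinh_coef sinh_coef) n.
Proof.
unfold legendre. rewrite conv_assoc. f_equal.
set (D := conv sinh_coef sinh_coef).
assert (HD : forall i, conv (theta sinh_coef) sinh_coef i = / 2 * theta D i).
{ intros i. unfold D. rewrite theta_conv, (conv_comm sinh_coef). field. }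
rewrite (conv_ext (theta (conv y sinh_coef))
  (fun i => conv (theta y) sinh_coef i + conv y (theta sinh_coef) i)
  sinh_coef sinh_coef); [|intros; apply theta_conv|reflexivity].
rewrite conv_add_l, !conv_assoc.
rewrite (conv_ext y y _ (fun i => / 2 * theta D i)); [|reflexivity|intros; apply HD].
fold D. unfold conv. rewrite <- sum_add, <- !sum_mull.
apply sum_ext. intros i Hi. unfold theta.
rewrite plus_INR, minus_INR by exact Hi. field.
Qed.

(** * The numbers beta *)

(** Coefficients of the expansion with the logarithm counted as the term of
    index 0; its sign makes the recursion for [beta] homogeneous. *)
Definition beta_ext (j : nat) : R := match j with O => -1 | S _ => beta j end.

(** 1 / N^(2j) is the Laplace transform of t^(2j-1) / (2j-1)!, and - ln N is that
    of 1 / t up to a constant. The weight is the coefficient of x^(2j-1) in twice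
    this function of t, for t = 2 x. *)
Definition weight (j : nat) : R :=
  match j with O => 1 | S _ => 4 ^ j / INR (fact (2 * j - 1)) end.

(** The series 1 / x - 2 phi (2 x), where phi is the function whose Laplace
    transform has the expansion with coefficients [beta]; it is a solution of
    Legendre's equation divided by sinh x. *)
Definition beta_gen (j : nat) : R := - beta_ext j * weight j.

(** The left side of the recursion at s = n + 2, truncated at index m. *)
Definition defect (m n : nat) : R :=
  sum_f_R0 (fun j => trunc m beta_ext j * d j (n + 2)) (S n).

Lemma pow_4 (k : nat) : 4 ^ k = 2 ^ (2 * k).
Proof. rewrite pow_mult. f_equal. lra. Qed.

(** In Laplace transforms N^2 is a second derivative in t and a difference is a
    multiplication by an exponential, so the two sides are coefficients of the
    same operator; what remains is an identity between factorials. *)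
Lemma weight_d (n j : nat) : (j <= S n)%nat ->
  weight j * (2 * INR (S n) * INR (S n + j) * conv sinh_coef sinh_coef (S n - j)
    + / 4 * (if (j =? S n)%nat then 0 else conv sinh_coef sinh_coef (n - j)))
  = 4 ^ S n / INR (fact (2 * n + 1)) * d j (n + 2).
Proof.
intros Hj. rewrite !sinh_sq_coef.
assert (F : forall i, INR (fact i) <> 0) by apply INR_fact_neq_0.
assert (P := pos_INR n).
destruct (Nat.eqb_spec j (S n)) as [->|Hne].
- unfold weight, d.  simpl (S n =? 0)%nat. cbv iota.
  replace (n + 2 =? S n + 1)%nat with true by (symmetry; apply Nat.eqb_eq; lia).
  rewrite Nat.sub_diag. simpl (2 * 0 + 1)%nat. simpl (2 * 0 + 2)%nat.
  replace (2 * S n - 1)%nat with (2 * n + 1)%nat by lia.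
  replace (S n + S n)%nat with (2 * S n)%nat by lia.
  rewrite mult_INR. simpl (INR 2). simpl (fact 2). simpl (INR 2). field. apply F.
- assert (exists k, n = j + k)%nat as [k ->] by (exists (n - j)%nat; lia). clear Hj Hne.
  replace (S (j + k) - j)%nat with (S k) by lia.
  replace (j + k - j)%nat with k by lia.
  replace (2 * S k + 1)%nat with (S (S (2 * k + 1))) by lia.
  replace (2 * S k + 2)%nat with (S (S (2 * k + 2))) by lia.
  set (D := 2 ^ (2 * k + 1)).
  assert (HD : D = 2 * 4 ^ k).
  { unfold D. rewrite pow_add, <- pow_4. ring. }
  change (2 ^ S (S (2 * k + 1))) with (2 * (2 * D)). rewrite HD. clear D HD.
  destruct j as [|j].
  + unfold weight, d. simpl (0 =? 0)%nat. cbv iota. simpl (0 + k)%nat.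
    rewrite Nat.add_0_r.
    change (fact (S (S (2 * k + 2)))) with
      (S (S (2 * k + 2)) * (S (2 * k + 2) * fact (2 * k + 2)))%nat.
    replace (2 * k + 2)%nat with (S (2 * k + 1)) by lia.
    change (fact (S (2 * k + 1))) with (S (2 * k + 1) * fact (2 * k + 1))%nat.
    rewrite !mult_INR, !S_INR, !plus_INR, !mult_INR.
    change (4 ^ S k) with (4 * 4 ^ k).
    simpl (INR 2). simpl (INR 1). simpl (0 + k)%nat in *.
    field. specialize (F (2 * k + 1)%nat).
    replace (INR (0 + k)) with (INR k) in P by reflexivity.
    repeat split; try lra; auto.
  + unfold weight, d. simpl (S j =? 0)%nat. cbv iota.
    replace (S j + k + 2 =? S j + 1)%nat with false
      by (symmetry; apply Nat.eqb_neq; lia).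
    replace (2 * (S j + k + 2) - 2 * S j - 2)%nat with (2 * k + 2)%nat by lia.
    replace (2 * (S j + k + 2) - 2 * S j)%nat with (S (S (2 * k + 2)))%nat by lia.
    replace (2 * (S j + k + 2) - 3)%nat with (2 * (S j + k) + 1)%nat by lia.
    replace (2 * (S j + k + 2) - 2)%nat with (S (2 * (S j + k) + 1))%nat by lia.
    replace (2 * (S j + k + 2) + 2 * S j - 2)%nat with (2 * (S (S j + k) + S j))%nat by lia.
    change (fact (S (S (2 * k + 2)))) with
      (S (S (2 * k + 2)) * (S (2 * k + 2) * fact (2 * k + 2)))%nat.
    change (fact (S (2 * (S j + k) + 1))) with
      (S (2 * (S j + k) + 1) * fact (2 * (S j + k) + 1))%nat.
    replace (4 ^ S (S j + k)) with (4 ^ S j * (4 * 4 ^ k)).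
    2:{ change (4 * 4 ^ k) with (4 ^ S k). rewrite <- pow_add. f_equal. lia. }
    assert (Q := pos_INR k). assert (Q' := pos_INR j).
    rewrite !mult_INR.
    generalize (F (2 * (S j + k) + 1)%nat) (F (2 * k + 2)%nat) (F (2 * S j - 1)%nat).
    generalize (INR (fact (2 * (S j + k) + 1))) (INR (fact (2 * k + 2)))
      (INR (fact (2 * S j - 1))) (4 ^ S j) (4 ^ k).
    intros f1 f2 f3 p1 p2 H1 H2 H3.
    rewrite ?plus_INR, ?mult_INR, ?S_INR, ?plus_INR, ?mult_INR, ?plus_INR, ?S_INR.
    simpl (INR 2). simpl (INR 1). simpl (INR 0).
    field. repeat split; auto; lra.
Qed.

Lemma legendre_beta (m n : nat) :
  legendre (conv (trunc m beta_gen) sinh_coef) n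
  = - (4 ^ S n / INR (fact (2 * n + 1))) * defect m n.
Proof.
rewrite legendre_conv_sinh. unfold defect.
transitivity (sum_f_R0 (fun j => trunc m beta_gen j *
  (2 * INR (S n) * INR (S n + j) * conv sinh_coef sinh_coef (S n - j)
    + / 4 * (if (j =? S n)%nat then 0 else conv sinh_coef sinh_coef (n - j)))) (S n)).
- rewrite (sum_ext (fun j => _ * (_ + _)) (fun j =>
    trunc m beta_gen j *
      (2 * INR (S n) * INR (S n + j) * conv sinh_coef sinh_coef (S n - j))
    + / 4 * (trunc m beta_gen j *
        (if (j =? S n)%nat then 0 else conv sinh_coef sinh_coef (n - j)))))
    by (intros; ring).
  rewrite sum_add, sum_mull. do 2 f_equal. rewrite sum_S, Nat.eqb_refl.
  rewrite Rmult_0_r, Rplus_0_r. apply sum_ext. intros i Hi.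
  now rewrite (proj2 (Nat.eqb_neq i (S n))) by lia.
- rewrite <- sum_mull. apply sum_ext. intros j Hj.
  transitivity (- trunc m beta_ext j * (4 ^ S n / INR (fact (2 * n + 1)) * d j (n + 2)));
    [|ring].
  rewrite <- weight_d by exact Hj. unfold trunc, beta_gen.
  destruct (j <=? m)%nat; ring.
Qed.

Lemma sum_n_m_Reals (f : nat -> R) (m : nat) :
  sum_n_m f 1 m = sum_f_R0 (fun j => match j with O => 0 | S _ => f j end) m.
Proof.
induction m as [|m IH].
- now rewrite sum_n_m_zero by lia.
- rewrite sum_n_Sm by lia. rewrite IH, sum_S. reflexivity.
Qed.

Lemma d_diag (n : nat) : d (S n) (n + 2) = 4 * INR (S n) ^ 2.
Proof.
unfold d. simpl (S n =? 0)%nat. cbv iota.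
now replace (n + 2 =? S n + 1)%nat with true by (symmetry; apply Nat.eqb_eq; lia).
Qed.

Lemma defect_zero (n m : nat) : (n < m)%nat -> defect m n = 0.
Proof.
intros Hm. unfold defect. rewrite sum_S, trunc_le by lia.
rewrite d_diag. unfold beta_ext at 2. rewrite (beta_rec (S n)) by lia.
rewrite sum_n_m_Reals. replace (S n - 1)%nat with n by lia.
replace (S n + 1)%nat with (n + 2)%nat by lia.
rewrite (sum_ext _ (fun j => match j with O => 0 | S _ => d j (n + 2) * beta j end
   + match j with O => - d 0 (n + 2) | S _ => 0 end)).
2:{ intros j Hj. rewrite trunc_le by lia. destruct j; simpl; ring. }
rewrite sum_add.
replace (sum_f_R0 (fun j => match j with O => - d 0 (n + 2) | S _ => 0 end) n)
  with (- d 0 (n + 2)).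
2:{ destruct n as [|n]; [reflexivity|]. rewrite sum_split_first, sum_zero; auto; ring. }
field. apply not_0_INR. lia.
Qed.

(** [legendre_sinh_trunc_sign] applies to [beta_gen]: at a fixed order a late
    truncation changes nothing, and there the defect is 0 by [beta_rec]. *)
Lemma defect_sign (n m : nat) : (m <= n)%nat -> (-1) ^ m * defect m n < 0.
Proof.
intros Hm.
assert (pos : forall k, 0 < 4 ^ S k / INR (fact (2 * k + 1))).
{ intros k. apply Rdiv_lt_0_compat; [apply pow_lt; lra|apply INR_fact_lt_0]. }
assert (0 < (-1) ^ m * legendre (conv (trunc m beta_gen) sinh_coef) n).
{ apply legendre_sinh_trunc_sign; [unfold beta_gen; simpl; ring| |exact Hm].
  intros k. transitivity (legendre (conv (trunc (S k) beta_gen) sinh_coef) k).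
  - rewrite !legendre_conv_sinh. f_equal.
    + apply sum_ext. intros; now rewrite trunc_le by lia.
    + f_equal. apply conv_ext; [|reflexivity]. intros; now rewrite trunc_le by lia.
  - rewrite legendre_beta, defect_zero by lia. ring. }
rewrite legendre_beta in H. specialize (pos n). nra.
Qed.

(** * Power series of the difference operator *)

Lemma series_ext (a b : nat -> R) (l : R) :
  (forall n, a n = b n) -> is_series a l -> is_series b l.
Proof. exact (is_series_ext a b l). Qed.

Lemma series_add (a b : nat -> R) (la lb : R) :
  is_series a la -> is_series b lb -> is_series (fun n => a n + b n) (la + lb).
Proof. apply (is_series_plus (V := R_NormedModule)). Qed.

Lemma series_mull (c : R) (a : nat -> R) (l : R) :
  is_series a l -> is_series (fun n => c * a n) (c * l).
Proof. apply (is_series_scal_l (V := R_NormedModule)). Qed.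

Lemma series_limit (a : nat -> R) (l : R) :
  is_series a l <-> is_lim_seq (sum_f_R0 a) l.
Proof.
unfold is_series. split; intros H.
- apply is_lim_seq_ext with (2 := H). intros; apply sum_n_Reals.
- apply is_lim_seq_ext with (2 := H). intros; symmetry; apply sum_n_Reals.
Qed.

Lemma series_tail (a : nat -> R) (l : R) :
  is_series a l -> is_series (fun n => a (S n)) (l - a 0%nat).
Proof.
intros H. apply (is_series_incr_1 (V := R_NormedModule)).
replace (plus _ _) with l; [exact H|]. unfold plus; simpl; ring.
Qed.

Lemma series_pad (a : nat -> R) (k : nat) (l : R) :
  is_series a l ->
  is_series (fun n => if (n <? k)%nat then 0 else a (n - k)%nat) l.
Proof.
intros H. destruct k as [|k].
- revert H. apply series_ext. intros n. now rewrite Nat.sub_0_r.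
- apply (is_series_decr_n (V := R_NormedModule)) with (n := S k); [lia|].
  replace (plus l _) with l.
  + revert H. apply series_ext. intros n.
    rewrite (proj2 (Nat.ltb_ge _ _)) by lia. f_equal. lia.
  + rewrite (sum_n_Reals (fun n => if (n <? S k)%nat then 0 else a (n - S k)%nat)).
    rewrite sum_zero; [unfold plus, opp; simpl; ring|].
    intros i Hi. now rewrite (proj2 (Nat.ltb_lt _ _)) by (simpl in Hi; lia).
Qed.

Lemma series_pairs (a : nat -> R) (l : R) :
  is_series a l -> is_series (fun n => a (2 * n)%nat + a (2 * n + 1)%nat) l.
Proof.
rewrite !series_limit. intros H.
apply is_lim_seq_ext with (1 := fun n => sum_pairs a n).
apply (is_lim_seq_subseq (sum_f_R0 a) l (fun n => (2 * n + 1)%nat)); [|exact H].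
apply eventually_subseq. intros; lia.
Qed.

Lemma pow_neg (x : R) (n : nat) : (- x) ^ n = (-1) ^ n * x ^ n.
Proof. rewrite <- Rpow_mult_distr. f_equal. ring. Qed.

Lemma pow_m1_even (n : nat) : (-1) ^ (2 * n) = 1.
Proof. rewrite pow_mult. replace ((-1) ^ 2) with 1 by ring. apply pow1. Qed.

Lemma series_even (c : nat -> R) (x l1 l2 : R) :
  is_series (fun n => c n * x ^ n) l1 -> is_series (fun n => c n * (- x) ^ n) l2 ->
  is_series (fun n => 2 * c (2 * n)%nat * x ^ (2 * n)) (l1 + l2).
Proof.
intros H1 H2. assert (H := series_pairs _ _ (series_add _ _ _ _ H1 H2)).
revert H. apply series_ext. intros n.
rewrite !(pow_neg x), !pow_add, pow_m1_even. ring.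
Qed.

Lemma series_odd (c : nat -> R) (x l1 l2 : R) :
  is_series (fun n => c n * x ^ n) l1 -> is_series (fun n => c n * (- x) ^ n) l2 ->
  is_series (fun n => 2 * c (2 * n + 1)%nat * x ^ (2 * n + 1)) (l1 - l2).
Proof.
intros H1 H2.
assert (H := series_pairs _ _ (series_add _ _ _ _ H1 (series_mull (-1) _ _ H2))).
replace (l1 - l2) with (l1 + -1 * l2) by ring.
revert H. apply series_ext. intros n.
rewrite !(pow_neg x), !pow_add, pow_m1_even. ring.
Qed.

Lemma pseries_series (a : nat -> R) (x l : R) :
  is_pseries a x l -> is_series (fun n => a n * x ^ n) l.
Proof. exact (proj1 (is_pseries_R a x l)). Qed.

Lemma lim_INR_ratio (al : R) :
  is_lim_seq (fun n => (INR n + al) / INR (S n)) 1.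
Proof.
apply is_lim_seq_ext with (fun n => 1 + (al - 1) * / INR (S n)).
{ intros n. rewrite S_INR. pose proof (pos_INR n). field. lra. }
replace (Finite 1) with (Finite (1 + (al - 1) * 0)) by (f_equal; ring).
apply is_lim_seq_plus'; [apply is_lim_seq_const|].
apply is_lim_seq_mult'; [apply is_lim_seq_const|].
apply (is_lim_seq_incr_1 (fun n => / INR n) 0).
apply (is_lim_seq_inv INR p_infty); [apply is_lim_seq_INR|discriminate].
Qed.

(** The recursion for c says that the sum f satisfies (1 - z) f' = al f, so the
    product of f and (1 - z)^al is constant. *)
Lemma binomial_series (c : nat -> R) (al z : R) : 0 < al -> c 0%nat = 1 ->
  (forall r, INR (S r) * c (S r) = (INR r + al) * c r) -> Rabs z < 1 ->
  is_series (fun r => c r * z ^ r) (Rpower (1 - z) (- al)).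
Proof.
intros Hal c0 Hc Hz.
assert (Sp : forall r, 0 < INR (S r)) by (intros; apply lt_0_INR; lia).
assert (cp : forall r, 0 < c r).
{ induction r as [|r IH]; [lra|].
  apply (Rmult_lt_reg_l (INR (S r))); [apply Sp|].
  rewrite Rmult_0_r, Hc. pose proof (pos_INR r). nra. }
assert (Hcv : CV_radius c = 1).
{ replace (Finite 1) with (Finite (/ 1)) by (f_equal; field).
  apply CV_radius_finite_DAlembert; [intros r; specialize (cp r); lra|lra|].
  apply is_lim_seq_ext with (2 := lim_INR_ratio al). intros r.
  assert (E : c (S r) / c r = (INR r + al) / INR (S r)).
  { specialize (Hc r). specialize (cp r). specialize (Sp r).
    apply (Rmult_eq_reg_l (INR (S r) * c r)); [|nra].
    field_simplify; [|lra|lra]. lra. }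
  rewrite E, Rabs_pos_eq; [reflexivity|].
  apply Rlt_le, Rdiv_lt_0_compat; [pose proof (pos_INR r); lra|apply Sp]. }
assert (cvg : forall y, Rabs y < 1 -> Rbar_lt (Rabs y) (CV_radius c)).
{ intros y Hy. now rewrite Hcv. }
assert (ode : forall y, Rabs y < 1 ->
  (1 - y) * PSeries (PS_derive c) y = al * PSeries c y).
{ intros y Hy. specialize (cvg y Hy).
  assert (E0 := PSeries_correct _ _ (CV_radius_inside _ _ cvg)).
  assert (E1 := PSeries_correct _ _ (ex_pseries_derive _ _ cvg)).
  assert (E2 := is_pseries_incr_1 _ _ _ E1).
  apply pseries_series in E0, E1, E2.
  assert (E3 := series_add _ _ _ _ E1 (series_mull (-1) _ _ E2)).
  assert (E4 := series_mull al _ _ E0).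
  assert (E5 := is_series_unique _ _ E3). apply is_series_unique in E4.
  unfold scal in E5; simpl in E5; unfold mult in E5; simpl in E5.
  transitivity (PSeries (PS_derive c) y + -1 * (y * PSeries (PS_derive c) y)); [ring|].
  rewrite <- E5, <- E4. apply Series_ext. intros r.
  unfold PS_derive, PS_incr_1. destruct r as [|r].
  - specialize (Hc 0%nat). simpl in *. unfold zero; simpl. lra.
  - rewrite (Hc (S r)), S_INR. ring. }
set (h := fun y => PSeries c y * Rpower (1 - y) al).
assert (dh : forall y, Rabs y < 1 -> is_derive h y 0).
{ intros y Hy. unfold h. apply Rabs_def2 in Hy as Hy'.
  replace 0 with (PSeries (PS_derive c) y * Rpower (1 - y) al
    + PSeries c y * (- al / (1 - y) * Rpower (1 - y) al)).
  - apply (is_derive_mult (PSeries c) (fun y => Rpower (1 - y) al)).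
    + now apply is_derive_PSeries, cvg.
    + unfold Rpower. auto_derive; [lra|]. fold (1 - y). field. lra.
    + intros; apply Rmult_comm.
  - transitivity (((1 - y) * PSeries (PS_derive c) y - al * PSeries c y)
      * (Rpower (1 - y) al / (1 - y))); [field; lra|].
    rewrite ode by exact Hy. ring. }
assert (hz : h z = h 0).
{ destruct (MVT_gen h 0 z (fun _ => 0)) as [y [_ Ey]]; [| |lra].
  - intros y Hy. apply dh. revert Hy. unfold Rmin, Rmax, Rabs in *.
    destruct (Rle_dec 0 z), (Rcase_abs z), (Rcase_abs y); lra.
  - intros y Hy. apply continuity_pt_filterlim.
    apply (derive_continuous h y 0), dh. revert Hy. unfold Rmin, Rmax, Rabs in *.
    destruct (Rle_dec 0 z), (Rcase_abs z), (Rcase_abs y); lra. }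
replace (Rpower (1 - z) (- al)) with (PSeries c z).
- apply pseries_series, PSeries_correct, CV_radius_inside, cvg, Hz.
- unfold h in hz. rewrite PSeries_0, c0, Rminus_0_r in hz.
  replace (Rpower 1 al) with 1 in hz
    by (unfold Rpower; now rewrite ln_1, Rmult_0_r, exp_0).
  rewrite Rpower_Ropp. assert (0 < Rpower (1 - z) al) by apply exp_pos.
  apply (Rmult_eq_reg_r (Rpower (1 - z) al)); [|lra].
  rewrite hz. field. lra.
Qed.

Lemma ln_series (z : R) : Rabs z < 1 ->
  is_series (fun r => (if (r =? 0)%nat then 0 else / INR r) * z ^ r) (- ln (1 - z)).
Proof.
intros Hz.
assert (Hcv : CV_radius (fun _ => 1) = 1).
{ replace (Finite 1) with (Finite (/ 1)) by (f_equal; field).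
  apply CV_radius_finite_DAlembert; [intros; lra|lra|].
  apply is_lim_seq_ext with (fun _ => 1); [|apply is_lim_seq_const].
  intros. rewrite Rdiv_1_r, Rabs_R1. reflexivity. }
assert (H := is_pseries_RInt (fun _ => 1) z).
rewrite Hcv in H. specialize (H Hz). apply pseries_series in H.
replace (- ln (1 - z)) with (RInt (PSeries (fun _ => 1)) 0 z).
- revert H. apply series_ext. intros [|r]; unfold PS_Int; simpl (_ =? _)%nat; 
    cbv iota; f_equal.
  unfold Rdiv; ring.
- assert (Hy : forall y, Rmin 0 z <= y <= Rmax 0 z -> Rabs y < 1).
  { intros y. unfold Rmin, Rmax, Rabs in *.
    destruct (Rle_dec 0 z), (Rcase_abs z), (Rcase_abs y); lra. }
  rewrite (RInt_ext (V := R_CompleteNormedModule) _ (fun y => / (1 - y))).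
  + apply is_RInt_unique.
    replace (- ln (1 - z)) with (minus (- ln (1 - z)) (- ln (1 - 0))).
    2:{ unfold minus, plus, opp; simpl. rewrite Rminus_0_r, ln_1. ring. }
    apply (is_RInt_derive (V := R_CompleteNormedModule)
      (fun y => - ln (1 - y)) (fun y => / (1 - y))).
    * intros y H1. apply Hy, Rabs_def2 in H1. auto_derive; [lra|]. field. lra.
    * intros y H1. apply Hy, Rabs_def2 in H1.
      apply (ex_derive_continuous (V := R_NormedModule) (fun y => / (1 - y))).
      auto_derive. lra.
  + intros y H1. apply is_pseries_unique, is_pseries_R.
    apply series_ext with (2 := is_series_geom y (Hy y ltac:(lra))).
    intros; ring.
Qed.

(** The symmetric form, around N = n + 3/4, of the recursion
    (n+1)^2 (G_(n+1) - G_n) = (n+1/2)^2 (G_n - G_(n-1)). *)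
Definition landau_op (f : R -> R) (N : R) : R :=
  (N + 1 / 4) ^ 2 * (f (N + 1) - f N) - (N - 1 / 4) ^ 2 * (f N - f (N - 1)).

Lemma inv_small (N : R) : 1 < N -> Rabs (/ N) < 1 /\ Rabs (- / N) < 1.
Proof.
intros HN. assert (0 < / N) by (apply Rinv_0_lt_compat; lra).
assert (/ N < 1) by (rewrite <- Rinv_1; apply Rinv_lt_contravar; lra).
rewrite Rabs_Ropp, Rabs_pos_eq; lra.
Qed.

(** Only even powers of 1 / N survive, because N -> - N leaves the form of
    [landau_op] unchanged; ln (N + 1) and ln (N - 1) enter through the even and
    the odd part of ln (1 - z). *)
Lemma landau_op_ln (N : R) : 1 < N ->
  is_series (fun n => - d 0 (n + 2) * (/ N) ^ (2 * n + 2)) (landau_op ln N).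
Proof.
intros HN. destruct (inv_small N HN) as [x1 x2].
set (x := / N) in *.
assert (Hx : 0 < x) by (apply Rinv_0_lt_compat; lra).
assert (HNx : N = / x) by (unfold x; now rewrite Rinv_inv).
set (c := fun r => if (r =? 0)%nat then 0 else / INR r).
assert (E1 := ln_series x x1). assert (E2 := ln_series (- x) x2).
fold c in E1, E2. unfold Rminus in E2. rewrite Ropp_involutive in E2.
assert (Ev := series_tail _ _ (series_even c x _ _ E1 E2)).
assert (Od := series_tail _ _ (series_odd c x _ _ E1 E2)).
assert (S := series_add _ _ _ _
  (series_add _ _ _ _ (series_mull (- N ^ 2) _ _ (series_tail _ _ Ev))
    (series_mull (- (1 / 16)) _ _ Ev)) (series_mull (N / 2) _ _ Od)).
assert (H1 : ln (N + 1) = ln N + ln (1 + x)).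
{ rewrite <- ln_mult by lra. f_equal. rewrite HNx. field. lra. }
assert (H2 : ln (N - 1) = ln N + ln (1 - x)).
{ rewrite <- ln_mult by (apply Rabs_def2 in x1; lra). f_equal. rewrite HNx. field. lra. }
assert (fin : forall P Q, P -> P = Q -> Q) by (intros P Q p <-; exact p).
unfold landau_op. rewrite H1, H2.
match goal with |- is_series _ ?l => replace l with
  (- N ^ 2 * (- ln (1 - x) + - ln (1 + x) - 2 * c (2 * 0)%nat * x ^ (2 * 0) -
    2 * c (2 * 1)%nat * x ^ (2 * 1)) +
  - (1 / 16) * (- ln (1 - x) + - ln (1 + x) - 2 * c (2 * 0)%nat * x ^ (2 * 0)) +
  N / 2 * (- ln (1 - x) - - ln (1 + x) - 2 * c (2 * 0 + 1)%nat * x ^ (2 * 0 + 1))) end.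
- revert S. apply series_ext. intros n. unfold c.
  replace (2 * S (S n) =? 0)%nat with false by (symmetry; apply Nat.eqb_neq; lia).
  replace (2 * S n =? 0)%nat with false by (symmetry; apply Nat.eqb_neq; lia).
  replace (2 * S n + 1 =? 0)%nat with false by (symmetry; apply Nat.eqb_neq; lia).
  unfold d. simpl (0 =? 0)%nat. cbv iota.
  replace (2 * S (S n))%nat with (S (S (2 * n + 2))) by lia.
  replace (2 * S n + 1)%nat with (S (2 * n + 2)) by lia.
  replace (2 * S n)%nat with (2 * n + 2)%nat by lia.
  rewrite <- !tech_pow_Rmult, HNx, !S_INR, !plus_INR, !mult_INR.
  simpl (INR 2). pose proof (pos_INR n). field. repeat split; lra.
- unfold c. simpl. rewrite HNx. field. lra.
Qed.

(** The same with (1 - z)^(-2j) in place of ln (1 - z). The series starts at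
    1 / N^(2j), which is s = j + 1; the terms before it are 0. *)
Lemma landau_op_pow (j : nat) (N : R) : 1 < N -> (1 <= j)%nat ->
  is_series (fun n => if (n + 1 <? j)%nat then 0 else d j (n + 2) * (/ N) ^ (2 * n + 2))
    (landau_op (fun y => / y ^ (2 * j)) N).
Proof.
intros HN Hj. destruct (inv_small N HN) as [x1 x2].
set (x := / N) in *.
assert (Hx : 0 < x) by (apply Rinv_0_lt_compat; lra).
assert (HNx : N = / x) by (unfold x; now rewrite Rinv_inv).
assert (F : forall i, INR (fact i) <> 0) by apply INR_fact_neq_0.
set (c := fun r => INR (fact (2 * j - 1 + r)) / (INR (fact (2 * j - 1)) * INR (fact r))).
assert (c0 : c 0%nat = 1).
{ unfold c. rewrite Nat.add_0_r. simpl (fact 0). simpl (INR 1). field. apply F. }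
assert (Hc : forall r, INR (S r) * c (S r) = (INR r + INR (2 * j)) * c r).
{ intros r. unfold c. replace (2 * j - 1 + S r)%nat with (S (2 * j - 1 + r)) by lia.
  change (fact (S (2 * j - 1 + r)))
    with (S (2 * j - 1 + r) * fact (2 * j - 1 + r))%nat.
  replace (S (2 * j - 1 + r)) with (r + 2 * j)%nat by lia.
  change (fact (S r)) with (S r * fact r)%nat.
  rewrite (mult_INR (r + 2 * j)), (mult_INR (S r)), plus_INR.
  assert (INR (S r) <> 0) by (apply not_0_INR; lia). field. auto. }
assert (al : 0 < INR (2 * j)) by (apply lt_0_INR; lia).
assert (P : forall y, 0 < y -> Rpower y (- INR (2 * j)) = / y ^ (2 * j)).
{ intros y Hy. now rewrite Rpower_Ropp, Rpower_pow. }
assert (E1 := binomial_series c _ x al c0 Hc x1).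
assert (E2 := binomial_series c _ (- x) al c0 Hc x2).
apply Rabs_def2 in x1 as [x1 _].
rewrite (P (1 - x)) in E1 by lra. rewrite (P (1 - - x)) in E2 by lra.
unfold Rminus in E2. rewrite Ropp_involutive in E2.
assert (Ev0 := series_even c x _ _ E1 E2).
assert (Ev := series_tail _ _ Ev0).
assert (Od := series_odd c x _ _ E1 E2).
assert (Ev' := series_pad _ 1 _ Ev).
assert (S := series_mull (x ^ (2 * j)) _ _ (series_add _ _ _ _
  (series_add _ _ _ _ (series_mull (N ^ 2) _ _ Ev) (series_mull (1 / 16) _ _ Ev'))
  (series_mull (- N / 2) _ _ Od))).
apply (series_pad _ (j - 1)) in S.
assert (H0 : / N ^ (2 * j) = x ^ (2 * j)) by (unfold x; now rewrite pow_inv).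
assert (H1 : / (N + 1) ^ (2 * j) = x ^ (2 * j) * / (1 + x) ^ (2 * j)).
{ rewrite <- H0, <- Rinv_mult, <- Rpow_mult_distr. do 2 f_equal. rewrite HNx. field. lra. }
assert (H2 : / (N - 1) ^ (2 * j) = x ^ (2 * j) * / (1 - x) ^ (2 * j)).
{ rewrite <- H0, <- Rinv_mult, <- Rpow_mult_distr. do 2 f_equal. rewrite HNx. field. lra. }
unfold landau_op. rewrite H0, H1, H2.
match type of S with is_series _ ?l => match goal with |- is_series _ ?l' =>
  replace l' with l end end.
- revert S. apply series_ext. intros n.
  destruct (Nat.ltb_spec n (j - 1)) as [Hn|Hn].
  { now rewrite (proj2 (Nat.ltb_lt _ _)) by lia. }
  rewrite (proj2 (Nat.ltb_ge (n + 1) j)) by lia.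
  assert (exists i, n = j - 1 + i)%nat as [i ->] by (exists (n - (j - 1))%nat; lia).
  replace (j - 1 + i - (j - 1))%nat with i by lia.
  replace (2 * (j - 1 + i) + 2)%nat with (2 * j + 2 * i)%nat by lia.
  rewrite pow_add.
  assert (C1 := Hc (2 * i)%nat). assert (C2 := Hc (S (2 * i))).
  rewrite !(S_INR (S (2 * i))), !(S_INR (2 * i)) in C2. rewrite !(S_INR (2 * i)) in C1.
  rewrite (mult_INR 2 i) in C1, C2. simpl (INR 2) in C1, C2.
  assert (Q := pos_INR i).
  replace (2 * S i)%nat with (S (S (2 * i))) by lia.
  replace (2 * i + 1)%nat with (S (2 * i)) by lia.
  assert (C1' : c (S (2 * i)) = (2 * INR i + INR (2 * j)) * c (2 * i)%nat
    / (2 * INR i + 1)).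
  { apply (Rmult_eq_reg_l (2 * INR i + 1)); [|lra]. 
    transitivity ((2 * INR i + INR (2 * j)) * c (2 * i)%nat); [lra|field; lra]. }
  assert (C2' : c (S (S (2 * i))) = (2 * INR i + 1 + INR (2 * j)) * c (S (2 * i))
    / (2 * INR i + 2)).
  { apply (Rmult_eq_reg_l (2 * INR i + 2)); [|lra].
    transitivity ((2 * INR i + 1 + INR (2 * j)) * c (S (2 * i))); [lra|field; lra]. }
  rewrite C2', C1'. rewrite (mult_INR 2 j). simpl (INR 2).
  rewrite <- !tech_pow_Rmult, HNx.
  unfold d. replace (j =? 0)%nat with false by (symmetry; apply Nat.eqb_neq; lia).
  destruct i as [|i].
  + replace (j - 1 + 0 + 2 =? j + 1)%nat with true by (symmetry; apply Nat.eqb_eq; lia).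
    simpl (2 * 0)%nat. rewrite c0, Nat.add_0_r. simpl. field. lra.
  + replace (j - 1 + S i + 2 =? j + 1)%nat with false
      by (symmetry; apply Nat.eqb_neq; lia).
    rewrite (proj2 (Nat.ltb_ge (S i) 1)) by lia.
    replace (2 * S (S i - 1))%nat with (2 * S i)%nat by lia.
    assert (d2 : INR (fact (2 * (j - 1 + S i + 2) - 3))
      / (8 * INR (fact (2 * (j - 1 + S i + 2) - 2 * j - 2)) * INR (fact (2 * j - 1)))
      = c (2 * S i)%nat / 8).
    { unfold c. replace (2 * (j - 1 + S i + 2) - 3)%nat
        with (2 * j - 1 + 2 * S i)%nat by lia.
      replace (2 * (j - 1 + S i + 2) - 2 * j - 2)%nat with (2 * S i)%nat by lia.
      field. auto. }
    assert (d1 : INR (2 * (j - 1 + S i + 2) + 2 * j - 2)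
        * INR (fact (2 * (j - 1 + S i + 2) - 2))
      / (INR (fact (2 * (j - 1 + S i + 2) - 2 * j)) * INR (fact (2 * j - 1)))
      = (4 * INR j + 2 * INR (S i)) * (2 * INR j + 2 * INR (S i)) * c (2 * S i)%nat
        / ((2 * INR (S i) + 2) * (2 * INR (S i) + 1))).
    { unfold c. replace (2 * (j - 1 + S i + 2) + 2 * j - 2)%nat
        with (4 * j + 2 * S i)%nat by lia.
      replace (2 * (j - 1 + S i + 2) - 2)%nat with (S (2 * j - 1 + 2 * S i)) by lia.
      replace (2 * (j - 1 + S i + 2) - 2 * j)%nat with (S (S (2 * S i))) by lia.
      change (fact (S (S (2 * S i))))
        with (S (S (2 * S i)) * (S (2 * S i) * fact (2 * S i)))%nat.
      change (fact (S (2 * j - 1 + 2 * S i)))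
        with (S (2 * j - 1 + 2 * S i) * fact (2 * j - 1 + 2 * S i))%nat.
      replace (S (2 * j - 1 + 2 * S i)) with (2 * j + 2 * S i)%nat by lia.
      generalize (F (2 * j - 1 + 2 * S i)%nat) (F (2 * S i)%nat) (F (2 * j - 1)%nat).
      rewrite !(mult_INR _ (_ * _)), !(mult_INR _ (fact _)).
      generalize (INR (fact (2 * j - 1 + 2 * S i))) (INR (fact (2 * S i)))
        (INR (fact (2 * j - 1))).
      intros f1 f2 f3 F1 F2 F3. rewrite (S_INR (S _)), (S_INR (2 * _)), !plus_INR.
      rewrite !mult_INR. set (y := INR (S i)) in *. simpl (INR 2). simpl (INR 4).
      field. repeat split; auto; lra. }
    rewrite d1, d2, pow_add, !pow_O.
    generalize (c (2 * S i)%nat) (x ^ (2 * j)) (x ^ (2 * S i)). intros u v w.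
    field. repeat split; lra.
- rewrite Nat.mul_0_r, c0, pow_O, HNx.
  generalize (x ^ (2 * j)) (/ (1 - x) ^ (2 * j)) (/ (1 + x) ^ (2 * j)).
  intros u v w. field. lra.
Qed.

(** * From the recursion to inequalities *)

Definition expansion (m : nat) (N : R) : R :=
  ln N + sum_n_m (fun s => beta s / N ^ (2 * s)) 1 m.

Lemma expansion_S (m : nat) (N : R) :
  expansion (S m) N = expansion m N + beta (S m) * / N ^ (2 * S m).
Proof.
unfold expansion. rewrite Rplus_assoc. f_equal. 
apply (sum_n_Sm (G := R_AbelianMonoid) (fun s => beta s / N ^ (2 * s)) 1 m). lia.
Qed.

Lemma expansion_0 (N : R) : expansion 0 N = ln N.
Proof. unfold expansion. rewrite sum_n_m_zero by lia. apply Rplus_0_r. Qed.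

Lemma defect_S (m n : nat) : defect (S m) n =
  defect m n + beta (S m) * (if (n + 1 <? S m)%nat then 0 else d (S m) (n + 2)).
Proof.
set (f := fun j => (trunc (S m) beta_ext j - trunc m beta_ext j) * d j (n + 2)).
transitivity (defect m n + sum_f_R0 f (S n)).
- unfold defect. rewrite <- sum_add. apply sum_ext. intros; unfold f; ring.
- f_equal. rewrite (sum_single f (S m)).
  + replace (n + 1)%nat with (S n) by lia.
    destruct (S n <? S m)%nat; [ring|].
    unfold f. rewrite trunc_le, trunc_gt by lia. simpl. ring.
  + intros j Hj. unfold f, trunc.
    destruct (Nat.leb_spec j (S m)), (Nat.leb_spec j m); try lia; ring.
Qed.

Lemma landau_op_expansion (m : nat) (N : R) : 1 < N ->
  is_series (fun n => defect m n * (/ N) ^ (2 * n + 2)) (landau_op (expansion m) N).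
Proof.
intros HN. induction m as [|m IH].
- replace (landau_op (expansion 0) N) with (landau_op ln N).
  2:{ unfold landau_op. now rewrite !expansion_0. }
  generalize (landau_op_ln N HN). apply series_ext. intros n. f_equal.
  unfold defect. rewrite (sum_single _ 0).
  + rewrite trunc_le by lia. simpl. ring.
  + intros j Hj. rewrite trunc_gt by lia. ring.
- assert (H := series_add _ _ _ _ IH
    (series_mull (beta (S m)) _ _ (landau_op_pow (S m) N HN ltac:(lia)))).
  replace (landau_op (expansion (S m)) N) with (landau_op (expansion m) N
    + beta (S m) * landau_op (fun y => / y ^ (2 * S m)) N).
  + revert H. apply series_ext. intros n. rewrite defect_S.
    destruct (n + 1 <? S m)%nat; ring.
  + unfold landau_op. rewrite !expansion_S. ring.
Qed.

Lemma series_pos (a : nat -> R) (l : R) (m : nat) : is_series a l ->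
  (forall n, 0 <= a n) -> 0 < a m -> 0 < l.
Proof.
intros H Ha Hm. apply series_limit in H.
apply Rlt_le_trans with (sum_f_R0 a m).
- destruct m as [|m]; [exact Hm|]. rewrite sum_S.
  pose proof (sum_nonneg a m (fun i _ => Ha i)). lra.
- apply (is_lim_seq_incr_compare (sum_f_R0 a) l H).
  intros n. rewrite sum_S. specialize (Ha (S n)). lra.
Qed.

Lemma landau_op_expansion_sign (m : nat) (N : R) : 1 < N ->
  (-1) ^ m * landau_op (expansion m) N < 0.
Proof.
intros HN.
assert (Hx : forall k, 0 < (/ N) ^ k).
{ intros k. apply pow_lt, Rinv_0_lt_compat. lra. }
enough (0 < - (-1) ^ m * landau_op (expansion m) N) by lra.
apply (series_pos _ _ m (series_mull (- (-1) ^ m) _ _ (landau_op_expansion m N HN))).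
- intros n. specialize (Hx (2 * n + 2)%nat).
  destruct (le_lt_dec m n) as [Hn|Hn].
  + pose proof (defect_sign n m Hn). nra.
  + rewrite defect_zero by exact Hn. lra.
- specialize (Hx (2 * m + 2)%nat). pose proof (defect_sign m m (le_n m)). nra.
Qed.

(** The increasing quotients must stay negative: if one were nonnegative, the
    later ones would exceed a positive constant, and r would grow as fast as a
    multiple of G. So r decreases to its limit 0. *)
Lemma relative_monotone_pos (r G : nat -> R) :
  (forall n, 0 < G (S n) - G n) -> is_lim_seq G p_infty -> is_lim_seq r 0 ->
  (forall n, (r (S n) - r n) / (G (S n) - G n)
     < (r (S (S n)) - r (S n)) / (G (S (S n)) - G (S n))) ->
  forall n, 0 < r n.
Proof.
intros HG Glim rlim Hmono.
set (T := fun n => (r (S n) - r n) / (G (S n) - G n)).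
assert (Tmono : forall k n, T n <= T (n + k)%nat).
{ induction k as [|k IH]; intros n.
  - rewrite Nat.add_0_r. lra.
  - specialize (IH n). pose proof (Hmono (n + k)%nat).
    replace (n + S k)%nat with (S (n + k)) by lia. unfold T in *. lra. }
assert (Er : forall n, r (S n) - r n = T n * (G (S n) - G n)).
{ intros n. unfold T. field. specialize (HG n). lra. }
assert (Tneg : forall n, T n < 0).
{ intros n0. apply Rnot_le_lt. intros H0.
  assert (He : 0 < T (S n0)) by (pose proof (Hmono n0); unfold T in *; lra).
  set (e := T (S n0)) in *. set (n1 := S n0) in *.
  assert (Hgrow : forall k, r n1 + e * (G (n1 + k)%nat - G n1) <= r (n1 + k)%nat).
  { induction k as [|k IH]; [rewrite Nat.add_0_r; lra|].
    replace (n1 + S k)%nat with (S (n1 + k)) by lia.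
    pose proof (Er (n1 + k)%nat). pose proof (Tmono k n1). fold e in H1.
    specialize (HG (n1 + k)%nat). nra. }
  assert (is_lim_seq (fun k => r (k + n1)%nat) p_infty).
  { apply is_lim_seq_le_p_loc with (fun k => (r n1 - e * G n1) + e * G (k + n1)%nat).
    - exists 0%nat. intros k _. specialize (Hgrow k).
      rewrite Nat.add_comm. lra.
    - apply (is_lim_seq_incr_n G n1 p_infty) in Glim.
      apply is_lim_seq_plus with (r n1 - e * G n1) p_infty;
        [apply is_lim_seq_const| |reflexivity].
      replace p_infty with (Rbar_mult e p_infty).
      + now apply is_lim_seq_scal_l.
      + unfold Rbar_mult, Rbar_mult'. destruct (Rle_dec 0 e); [|lra].
        destruct (Rle_lt_or_eq_dec 0 e r0); [reflexivity|lra]. }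
  apply (is_lim_seq_incr_n r n1 0) in rlim.
  apply is_lim_seq_unique in rlim, H. rewrite H in rlim. discriminate. }
assert (dec : forall n, r (S n) < r n).
{ intros n. pose proof (Er n). specialize (Tneg n). specialize (HG n). nra. }
intros n. apply Rle_lt_trans with (r (S n)); [|apply dec].
apply (is_lim_seq_decr_compare r 0 rlim). intros k. specialize (dec k). lra.
Qed.

Lemma oddeven_ratio_S (k : nat) : oddeven_ratio (S k)
  = oddeven_ratio k * ((2 * INR (S k) - 1) / (2 * INR (S k))).
Proof. reflexivity. Qed.

Lemma oddeven_ratio_pos (k : nat) : 0 < oddeven_ratio k.
Proof.
induction k as [|k IH]; [simpl; lra|]. rewrite oddeven_ratio_S.
apply Rmult_lt_0_compat; [exact IH|].
pose proof (pos_INR k). rewrite S_INR. apply Rdiv_lt_0_compat; lra.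
Qed.

Lemma landau_G_S (n : nat) :
  landau_G (S n) - landau_G n = oddeven_ratio (S n) ^ 2.
Proof.
unfold landau_G. rewrite sum_Sn. apply Rplus_minus_l.
Qed.

Lemma lim_pow (x : nat -> R) (l : R) (k : nat) :
  is_lim_seq x l -> is_lim_seq (fun n => x n ^ k) (l ^ k).
Proof.
intros H. induction k as [|k IH]; [apply is_lim_seq_const|].
now apply is_lim_seq_mult'.
Qed.

Lemma lim_shifted : is_lim_seq (fun n => INR n + 3 / 4) p_infty.
Proof.
apply is_lim_seq_plus with p_infty (3 / 4);
  [apply is_lim_seq_INR|apply is_lim_seq_const|reflexivity].
Qed.

Lemma expansion_limit (m : nat) :
  is_lim_seq (fun n => expansion m (INR n + 3 / 4) - ln (INR n + 3 / 4)) 0.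
Proof.
induction m as [|m IH].
- apply is_lim_seq_ext with (fun _ => 0); [|apply is_lim_seq_const].
  intros n. rewrite expansion_0. ring.
- apply is_lim_seq_ext with (fun n =>
    (expansion m (INR n + 3 / 4) - ln (INR n + 3 / 4))
    + beta (S m) * (/ (INR n + 3 / 4)) ^ (2 * S m)).
  { intros n. rewrite expansion_S, pow_inv. ring. }
  replace (Finite 0) with (Finite (0 + beta (S m) * 0 ^ (2 * S m)))
    by (rewrite pow_i by lia; f_equal; ring).
  apply is_lim_seq_plus'; [exact IH|].
  apply is_lim_seq_mult'; [apply is_lim_seq_const|].
  apply lim_pow, (is_lim_seq_inv (fun n => INR n + 3 / 4) p_infty);
    [apply lim_shifted|discriminate].
Qed.

Lemma ln_limit : is_lim_seq (fun n => ln (INR n + 3 / 4)) p_infty.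
Proof.
apply (filterlim_comp nat R R (fun n => INR n + 3 / 4) ln eventually (Rbar_locally p_infty)).
- apply lim_shifted.
- apply is_lim_ln_p.
Qed.

(** [landau_op] applied to the error is, up to a positive factor, the increment
    of its difference quotient with respect to [landau_G], because
    (N - 1/4)^2 / (N + 1/4)^2 is the ratio of two successive terms of that sum. *)
Lemma expansion_error_sign (K : R) :
  is_lim_seq (fun n => PI * landau_G n - ln (INR n + 3 / 4)) K ->
  forall m n, 0 < (-1) ^ m * (PI * landau_G n - (expansion m (INR n + 3 / 4) + K)).
Proof.
intros HK m.
assert (HG : forall n, 0 < landau_G (S n) - landau_G n).
{ intros n. rewrite landau_G_S. apply pow_lt, oddeven_ratio_pos. }
apply (relative_monotone_pos
  (fun n => (-1) ^ m * (PI * landau_G n - (expansion m (INR n + 3 / 4) + K))) landau_G).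
- exact HG.
- apply is_lim_seq_ext with (fun n => / PI *
    (ln (INR n + 3 / 4) + (PI * landau_G n - ln (INR n + 3 / 4)))).
  { intros n. field. apply PI_neq0. }
  assert (0 < / PI) by apply Rinv_0_lt_compat, PI_RGT_0.
  replace p_infty with (Rbar_mult (/ PI) p_infty).
  + apply is_lim_seq_scal_l.
    apply is_lim_seq_plus with p_infty K; [apply ln_limit|exact HK|reflexivity].
  + unfold Rbar_mult, Rbar_mult'. destruct (Rle_dec 0 (/ PI)); [|lra].
    destruct (Rle_lt_or_eq_dec 0 (/ PI) r); [reflexivity|lra].
- replace (Finite 0) with (Finite ((-1) ^ m * (K - K - 0))) by (f_equal; ring).
  apply is_lim_seq_mult'; [apply is_lim_seq_const|].
  apply is_lim_seq_ext with (fun n => (PI * landau_G n - ln (INR n + 3 / 4)) - K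
    - (expansion m (INR n + 3 / 4) - ln (INR n + 3 / 4))); [intros; ring|].
  apply is_lim_seq_minus'; [|apply expansion_limit].
  apply is_lim_seq_minus'; [exact HK|apply is_lim_seq_const].
- intros n. cbv beta.
  set (N := INR (S n) + 3 / 4).
  assert (HN : 1 < N) by (unfold N; rewrite S_INR; pose proof (pos_INR n); lra).
  assert (H := landau_op_expansion_sign m N HN). unfold landau_op in H.
  replace (INR (S (S n)) + 3 / 4) with (N + 1) by (unfold N; rewrite !S_INR; ring).
  replace (INR n + 3 / 4) with (N - 1) by (unfold N; rewrite !S_INR; ring).
  assert (E1 := landau_G_S n). assert (E2 := landau_G_S (S n)).
  set (u := oddeven_ratio (S n)) in *.
  assert (Hu : 0 < u) by apply oddeven_ratio_pos.
  set (g := landau_G (S n)) in *.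
  assert (E3 : oddeven_ratio (S (S n)) = u * ((N - 1 / 4) / (N + 1 / 4))).
  { rewrite oddeven_ratio_S. fold u. f_equal. unfold N. rewrite !S_INR. pose proof (pos_INR n). field. lra. }
  rewrite E3 in E2. rewrite E1, E2.
  replace (landau_G (S (S n))) with (g + (u * ((N - 1 / 4) / (N + 1 / 4))) ^ 2) by lra.
  replace (landau_G n) with (g - u ^ 2) by lra.
  set (s := (-1) ^ m) in *.
  set (e0 := expansion m (N - 1)) in *. set (e1 := expansion m N) in *.
  set (e2 := expansion m (N + 1)) in *.
  apply Rlt_0_minus.
  replace (_ - _) with (- (s * ((N + 1 / 4) ^ 2 * (e2 - e1)
     - (N - 1 / 4) ^ 2 * (e1 - e0))) / (u ^ 2 * (N - 1 / 4) ^ 2)).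
  + apply Rdiv_lt_0_compat; [lra|].
    apply Rmult_lt_0_compat; apply pow_lt; lra.
  + field. repeat split; lra.
Qed.

(** * The constant term *)

Lemma ln_le_sub1 (y : R) : 0 < y -> ln y <= y - 1.
Proof. intros Hy. pose proof (exp_ineq1_le (ln y)). rewrite exp_ln in H; lra. Qed.

Lemma sub_inv_le_ln (y : R) : 0 < y -> 1 - / y <= ln y.
Proof.
intros Hy. pose proof (ln_le_sub1 (/ y) (Rinv_0_lt_compat y Hy)).
rewrite ln_Rinv in H by exact Hy. lra.
Qed.

Lemma harmonic_S (n : nat) :
  sum_n_m (fun k => / INR k) 1 (S n) = sum_n_m (fun k => / INR k) 1 n + / INR (S n).
Proof. apply (sum_n_Sm (G := R_AbelianMonoid) (fun k => / INR k) 1 n). lia. Qed.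

Lemma euler_gamma_limit :
  is_lim_seq (fun n => sum_n_m (fun k => / INR k) 1 (S n) - ln (INR (S n))) euler_gamma.
Proof.
apply Lim_seq_correct'.
assert (Sp : forall n, 0 < INR (S n)) by (intros; apply lt_0_INR; lia).
assert (step : forall n, / INR (S (S n)) <= ln (INR (S (S n))) - ln (INR (S n))
   <= / INR (S n)).
{ intros n. rewrite <- ln_div by auto. rewrite (S_INR (S n)).
  specialize (Sp n). split.
  - eapply Rle_trans; [|apply sub_inv_le_ln].
    + right. field. lra.
    + apply Rdiv_lt_0_compat; lra.
  - eapply Rle_trans; [apply ln_le_sub1|].
    + apply Rdiv_lt_0_compat; lra.
    + right. field. lra. }
apply ex_finite_lim_seq_decr with 0.
- intros n. rewrite (harmonic_S (S n)). specialize (step n). lra.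
- intros n.
  enough (ln (INR (S (S n))) <= sum_n_m (fun k => / INR k) 1 (S n)).
  { specialize (step n). pose proof (Rinv_0_lt_compat _ (Sp (S n))). lra. }
  induction n as [|n IH].
  + rewrite sum_n_n. specialize (step 0%nat). simpl (INR 1) in *. rewrite ln_1 in step. lra.
  + rewrite (harmonic_S (S n)). specialize (step (S n)). lra.
Qed.

Lemma is_RInt_primitive (F f : R -> R) (a b : R) : a <= b ->
  (forall x, a <= x <= b -> is_derive F x (f x)) ->
  (forall x, a <= x <= b -> ex_derive f x) -> is_RInt f a b (F b - F a).
Proof.
intros Hab HF Hf. apply (is_RInt_derive (V := R_CompleteNormedModule) F f);
  rewrite Rmin_left, Rmax_right by exact Hab; [exact HF|].
intros x Hx. apply (ex_derive_continuous (V := R_NormedModule)). now apply Hf.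
Qed.

Definition wallis (k : nat) : R := RInt (fun t => sin t ^ k) 0 (PI / 2).

Lemma continuous_ex_RInt (f : R -> R) (a b : R) :
  (forall x, ex_derive f x) -> ex_RInt f a b.
Proof.
intros H. apply (ex_RInt_continuous (V := R_CompleteNormedModule)).
intros z _. apply (ex_derive_continuous (V := R_NormedModule)), H.
Qed.

Lemma ex_RInt_sin_pow (k : nat) (a b : R) : ex_RInt (fun t => sin t ^ k) a b.
Proof. apply continuous_ex_RInt. intros x. auto_derive. exact I. Qed.

Lemma wallis_rec (k : nat) : INR (k + 2) * wallis (k + 2) = INR (k + 1) * wallis k.
Proof.
assert (H : is_RInt (fun t => INR (k + 2) * sin t ^ (k + 2) - INR (k + 1) * sin t ^ k)
  0 (PI / 2) (- cos (PI / 2) * sin (PI / 2) ^ (k + 1) - - cos 0 * sin 0 ^ (k + 1))).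
{ apply (is_RInt_primitive (fun t => - cos t * sin t ^ (k + 1)));
    [pose proof PI_RGT_0; lra| |].
  - intros t _. auto_derive; [exact I|].
    replace (Init.Nat.pred (k + 1)) with k by lia.
    rewrite !plus_INR, !pow_add. simpl (INR 1). simpl (INR 2).
    pose proof (sin2_cos2 t) as E. unfold Rsqr in E.
    transitivity (sin t * sin t * sin t ^ k
      - (INR k + 1) * sin t ^ k * (cos t * cos t)); [simpl; ring|].
    replace (cos t * cos t) with (1 - sin t * sin t) by lra. simpl; ring.
  - intros t _. auto_derive. exact I. }
rewrite cos_PI2, sin_0, pow_i in H by lia.
apply (is_RInt_unique (V := R_CompleteNormedModule)) in H.
rewrite (RInt_minus (V := R_CompleteNormedModule)
  (fun t => INR (k + 2) * sin t ^ (k + 2)) (fun t => INR (k + 1) * sin t ^ k)) in H.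
- rewrite (RInt_scal (V := R_CompleteNormedModule) (fun t => sin t ^ (k + 2))) in H
    by apply ex_RInt_sin_pow.
  rewrite (RInt_scal (V := R_CompleteNormedModule) (fun t => sin t ^ k)) in H
    by apply ex_RInt_sin_pow.
  fold (wallis (k + 2)) (wallis k) in H.
  unfold minus, plus, opp, scal in H; simpl in H. unfold mult in H; simpl in H. lra.
- apply (ex_RInt_scal (V := R_NormedModule) (fun t => sin t ^ (k + 2))), ex_RInt_sin_pow.
- apply (ex_RInt_scal (V := R_NormedModule) (fun t => sin t ^ k)), ex_RInt_sin_pow.
Qed.

Lemma wallis_0 : wallis 0 = PI / 2.
Proof.
unfold wallis. rewrite (RInt_ext (V := R_CompleteNormedModule) _ (fun _ => 1)) by reflexivity.
rewrite (RInt_const (V := R_CompleteNormedModule)). unfold scal; simpl; unfold mult; simpl. ring.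
Qed.

Lemma wallis_1 : wallis 1 = 1.
Proof.
assert (H : is_RInt (fun t => sin t ^ 1) 0 (PI / 2) (- cos (PI / 2) - - cos 0)).
{ apply (is_RInt_primitive (fun t => - cos t)); [pose proof PI_RGT_0; lra| |].
  - intros t _. auto_derive; [exact I|]. ring.
  - intros t _. auto_derive. exact I. }
rewrite cos_PI2, cos_0 in H. unfold wallis.
rewrite (is_RInt_unique (V := R_CompleteNormedModule) _ _ _ _ H). ring.
Qed.

(** The recursion makes the left side independent of k. *)
Lemma wallis_product (k : nat) : INR (k + 1) * (wallis k * wallis (k + 1)) = PI / 2.
Proof.
induction k as [|k IH].
- simpl (0 + 1)%nat. rewrite wallis_0, wallis_1. simpl. ring.
- rewrite <- IH. replace (S k + 1)%nat with (k + 2)%nat by lia.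
  replace (k + 1)%nat with (S k) in * by lia.
  transitivity (wallis (S k) * (INR (k + 2) * wallis (k + 2))); [ring|].
  rewrite wallis_rec. replace (k + 1)%nat with (S k) by lia. ring.
Qed.

Lemma sin_nonneg (t : R) : 0 <= t <= PI / 2 -> 0 <= sin t.
Proof. intros Ht. apply sin_ge_0; pose proof PI_RGT_0; lra. Qed.

Lemma wallis_decr (k : nat) : wallis (S k) <= wallis k.
Proof.
pose proof PI_RGT_0.
apply RInt_le; [lra|apply ex_RInt_sin_pow|apply ex_RInt_sin_pow|].
intros t Ht. assert (0 <= sin t) by (apply sin_nonneg; lra).
pose proof (SIN_bound t). pose proof (pow_le (sin t) k H0). simpl. nra.
Qed.

Lemma wallis_even (k : nat) : wallis (2 * k) = PI / 2 * oddeven_ratio k.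
Proof.
induction k as [|k IH].
{ change (2 * 0)%nat with 0%nat. rewrite wallis_0. simpl. ring. }
rewrite oddeven_ratio_S. assert (H := wallis_rec (2 * k)). rewrite IH in H.
replace (2 * S k)%nat with (2 * k + 2)%nat by lia.
rewrite S_INR. rewrite !plus_INR, mult_INR in H. simpl (INR 2) in H. simpl (INR 1) in H.
pose proof (pos_INR k).
apply (Rmult_eq_reg_l (2 * INR k + 2)); [|lra].
transitivity ((2 * INR k + 1) * (PI / 2 * oddeven_ratio k)); [lra|].
field. lra.
Qed.

(** By [wallis_decr] the square of the integral of sin^(2k+2) is at most the
    product in [wallis_product]. *)
Lemma oddeven_ratio_sq_le (k : nat) : PI * oddeven_ratio (S k) ^ 2 <= / INR (S k).
Proof.
assert (H1 := wallis_product (2 * k + 1)). assert (H2 := wallis_decr (2 * k + 1)).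
replace (2 * k + 1 + 1)%nat with (2 * S k)%nat in H1 by lia.
replace (S (2 * k + 1)) with (2 * S k)%nat in H2 by lia.
rewrite wallis_even in H1, H2. rewrite mult_INR in H1. simpl (INR 2) in H1.
pose proof PI_RGT_0. pose proof (oddeven_ratio_pos (S k)).
assert (Sp : 0 < INR (S k)) by (apply lt_0_INR; lia).
set (a := oddeven_ratio (S k)) in *. set (w := wallis (2 * k + 1)) in *.
apply (Rmult_le_reg_l (INR (S k))); [exact Sp|].
rewrite Rinv_r by lra.
apply (Rmult_le_reg_l (PI / 2)); [lra|].
assert (0 < PI / 2 * a) by (apply Rmult_lt_0_compat; lra).
assert (PI / 2 * a * (PI / 2 * a) <= w * (PI / 2 * a)) by nra.
assert (0 < 2 * INR (S k)) by lra.
assert (2 * INR (S k) * (PI / 2 * a * (PI / 2 * a)) <= 2 * INR (S k) * (w * (PI / 2 * a))) by nra.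
replace (PI / 2 * (INR (S k) * (PI * a ^ 2)))
  with (2 * INR (S k) * (PI / 2 * a * (PI / 2 * a))) by field.
lra.
Qed.

Lemma oddeven_ratio_le_1 (k : nat) : oddeven_ratio k <= 1.
Proof.
induction k as [|k IH]; [simpl; lra|]. rewrite oddeven_ratio_S.
pose proof (oddeven_ratio_pos k).
assert (Sp : 0 < INR (S k)) by (apply lt_0_INR; lia).
assert ((2 * INR (S k) - 1) / (2 * INR (S k)) <= 1).
{ apply Rle_div_l; lra. }
nra.
Qed.

Lemma series_partial_le (a : nat -> R) (l : R) (n : nat) : is_series a l ->
  (forall i, 0 <= a (S i)) -> sum_f_R0 a n <= l.
Proof.
intros H Ha. apply series_limit in H.
apply (is_lim_seq_incr_compare (sum_f_R0 a) l H).
intros k. rewrite sum_S. specialize (Ha k). lra.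
Qed.

Lemma inv_sqrt_series (z : R) : 0 <= z < 1 ->
  is_series (fun k => oddeven_ratio k * z ^ k) (/ sqrt (1 - z)).
Proof.
intros Hz. rewrite <- Rpower_sqrt by lra. rewrite <- Rpower_Ropp.
apply binomial_series; [lra|reflexivity| |rewrite Rabs_pos_eq; lra].
intros r. rewrite oddeven_ratio_S. rewrite S_INR. pose proof (pos_INR r). field. lra.
Qed.

(** The coefficients lie between 0 and 1, so the tail of the series lies between
    0 and the tail of the geometric series. This is uniform in z <= x, which
    allows integration. *)
Lemma inv_sqrt_partial (z x : R) (n : nat) : 0 <= z <= x -> x < 1 ->
  sum_f_R0 (fun k => oddeven_ratio k * z ^ k) n <= / sqrt (1 - z)
  <= sum_f_R0 (fun k => oddeven_ratio k * z ^ k) n + x ^ S n / (1 - x).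
Proof.
intros Hz Hx. assert (H := inv_sqrt_series z ltac:(lra)).
assert (Hp : forall k, 0 <= z ^ k) by (intros; apply pow_le; lra).
split.
- apply (series_partial_le (fun k => oddeven_ratio k * z ^ k)); [exact H|].
  intros i. apply Rmult_le_pos; [apply Rlt_le, oddeven_ratio_pos|apply Hp].
- assert (Hg := is_series_geom z ltac:(rewrite Rabs_pos_eq; lra)).
  assert (H2 := series_partial_le _ _ n (series_add _ _ _ _ Hg (series_mull (-1) _ _ H))).
  rewrite sum_add, sum_mull in H2. rewrite tech3 in H2 by lra.
  assert (z ^ S n / (1 - z) <= x ^ S n / (1 - x)).
  { apply Rmult_le_compat; [apply Hp| |apply pow_incr; lra|].
    - apply Rlt_le, Rinv_0_lt_compat. lra.
    - apply Rinv_le_contravar; lra. }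
  assert (E : (1 - z ^ S n) / (1 - z) = / (1 - z) - z ^ S n / (1 - z)) by (field; lra).
  rewrite E in H2.
  enough (/ (1 - z) - z ^ S n / (1 - z) + -1 * sum_f_R0 (fun k => oddeven_ratio k * z ^ k) n
    <= / (1 - z) + -1 * / sqrt (1 - z)) by lra.
  apply H2. intros i. pose proof (Hp (S i)). pose proof (oddeven_ratio_le_1 (S i)). nra.
Qed.

(** The complete elliptic integral of the first kind, with x the squared modulus. *)
Definition elliptic (x : R) : R := RInt (fun t => / sqrt (1 - x * sin t ^ 2)) 0 (PI / 2).

Lemma sin_sq_bound (t : R) : 0 <= sin t ^ 2 <= 1.
Proof. pose proof (SIN_bound t). simpl. nra. Qed.

Lemma ex_RInt_elliptic (x a b : R) : 0 <= x < 1 ->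
  ex_RInt (fun t => / sqrt (1 - x * sin t ^ 2)) a b.
Proof.
intros Hx. apply continuous_ex_RInt. intros t. pose proof (sin_sq_bound t).
assert (0 < 1 - x * sin t ^ 2) by nra.
auto_derive. simpl in *. repeat split; [lra|].
apply Rgt_not_eq, sqrt_lt_R0. lra.
Qed.

Lemma RInt_oddeven_sum (x : R) (n : nat) :
  is_RInt (fun t => sum_f_R0 (fun k => oddeven_ratio k * (x * sin t ^ 2) ^ k) n) 0 (PI / 2)
    (/ 2 * sum_f_R0 (fun k => PI * oddeven_ratio k ^ 2 * x ^ k) n).
Proof.
assert (term : forall k, is_RInt (fun t => oddeven_ratio k * (x * sin t ^ 2) ^ k)
  0 (PI / 2) (/ 2 * (PI * oddeven_ratio k ^ 2 * x ^ k))).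
{ intros k.
  replace (/ 2 * _) with (oddeven_ratio k * x ^ k * wallis (2 * k))
    by (rewrite wallis_even; field).
  assert (E : forall t, oddeven_ratio k * x ^ k * sin t ^ (2 * k)
    = oddeven_ratio k * (x * sin t ^ 2) ^ k).
  { intros t. rewrite Rpow_mult_distr, pow_mult. ring. }
  apply (is_RInt_ext _ _ _ _ _ (fun t _ => E t)).
  apply (is_RInt_scal (V := R_NormedModule) (fun t => sin t ^ (2 * k))).
  apply (RInt_correct (V := R_CompleteNormedModule)), ex_RInt_sin_pow. }
induction n as [|n IH]; [apply term|].
rewrite sum_S, Rmult_plus_distr_l.
apply (is_RInt_plus (V := R_NormedModule) _ _ _ _ _ _ IH (term (S n))).
Qed.

Lemma RInt_mono (f g : R -> R) (a b lf lg : R) : a <= b ->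
  is_RInt f a b lf -> is_RInt g a b lg ->
  (forall t, a < t < b -> f t <= g t) -> lf <= lg.
Proof.
intros Hab Hf Hg H. apply (is_RInt_le f g a b); auto.
Qed.

Lemma elliptic_series (x : R) : 0 <= x < 1 ->
  is_series (fun k => PI * oddeven_ratio k ^ 2 * x ^ k) (2 * elliptic x).
Proof.
intros Hx. apply series_limit.
set (s := fun n => sum_f_R0 (fun k => PI * oddeven_ratio k ^ 2 * x ^ k) n).
pose proof PI_RGT_0 as Hpi.
assert (I : is_RInt (fun t => / sqrt (1 - x * sin t ^ 2)) 0 (PI / 2) (elliptic x)).
{ apply (RInt_correct (V := R_CompleteNormedModule)), ex_RInt_elliptic, Hx. }
assert (B : forall n t, sum_f_R0 (fun k => oddeven_ratio k * (x * sin t ^ 2) ^ k) n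
  <= / sqrt (1 - x * sin t ^ 2)
  <= sum_f_R0 (fun k => oddeven_ratio k * (x * sin t ^ 2) ^ k) n + x ^ S n / (1 - x)).
{ intros n t. apply inv_sqrt_partial; [|lra]. pose proof (sin_sq_bound t). nra. }
assert (B1 : forall n, s n <= 2 * elliptic x).
{ intros n. enough (/ 2 * s n <= elliptic x) by lra.
  apply (RInt_mono _ _ 0 (PI / 2) _ _ ltac:(lra) (RInt_oddeven_sum x n) I).
  intros t _. apply B. }
assert (B2 : forall n, 2 * elliptic x <= s n + PI / (1 - x) * x * x ^ n).
{ intros n.
  enough (elliptic x <= / 2 * s n + (PI / 2 - 0) * (x ^ S n / (1 - x))).
  { replace (PI / (1 - x) * x * x ^ n) with (2 * ((PI / 2 - 0) * (x ^ S n / (1 - x))))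
      by (simpl; field; lra). lra. }
  apply (RInt_mono _ _ 0 (PI / 2) _ _ ltac:(lra) I
    (is_RInt_plus (V := R_NormedModule) _ _ _ _ _ _ (RInt_oddeven_sum x n)
      (is_RInt_const (V := R_NormedModule) 0 (PI / 2) (x ^ S n / (1 - x))))).
  intros t _. apply B. }
apply is_lim_seq_le_le with (fun n => 2 * elliptic x - PI / (1 - x) * x * x ^ n)
  (fun _ => 2 * elliptic x).
- intros n. specialize (B1 n). specialize (B2 n). unfold s in *. lra.
- replace (Finite (2 * elliptic x))
    with (Finite (2 * elliptic x - PI / (1 - x) * x * 0)) by (f_equal; ring).
  apply is_lim_seq_minus'; [apply is_lim_seq_const|].
  apply is_lim_seq_mult'; [apply is_lim_seq_const|].
  apply is_lim_seq_geom. rewrite Rabs_pos_eq; lra.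
- apply is_lim_seq_const.
Qed.

(** Splitting the numerator as sin t + (1 - sin t) gives an elementary integral
    that carries the logarithm and one that stays bounded as the modulus
    tends to 1, with limit ln 2. *)
Lemma elliptic_asymptotic (e : R) : 0 < e < 1 ->
  let q := sqrt (1 - e ^ 2) in
  let L := ln (1 + q) / q + ln 2 in
  L - PI / 2 * e <= elliptic (1 - e ^ 2) + ln e <= L + e / (q * (1 + q)).
Proof.
intros He q L.
pose proof PI_RGT_0 as Hpi.
assert (Hx : 0 < 1 - e ^ 2 < 1) by (simpl; nra).
assert (Hq : 0 < q) by (apply sqrt_lt_R0; lra).
assert (Hqq : q * q = 1 - e ^ 2) by (apply sqrt_sqrt; lra).
set (w := fun t => sqrt (1 - (1 - e ^ 2) * sin t ^ 2)).
assert (wp : forall t, 0 < w t).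
{ intros t. apply sqrt_lt_R0. pose proof (sin_sq_bound t). nra. }
assert (ww : forall t, w t * w t = 1 - (1 - e ^ 2) * sin t ^ 2).
{ intros t. apply sqrt_sqrt. pose proof (sin_sq_bound t). nra. }
assert (cs : forall t, cos t * cos t = 1 - sin t * sin t).
{ intros t. pose proof (sin2_cos2 t) as E. unfold Rsqr in E. lra. }
assert (dw : forall t, is_derive w t (- (1 - e ^ 2) * sin t * cos t / w t)).
{ intros t. unfold w. pose proof (sin_sq_bound t). 
  assert (0 < 1 - (1 - e ^ 2) * sin t ^ 2) by nra.
  auto_derive; [simpl in *; lra|]. specialize (wp t). unfold w in wp.
  replace (1 + - ((1 - e * (e * 1)) * (sin t * (sin t * 1))))
    with (1 - (1 - e ^ 2) * sin t ^ 2) by (simpl; ring).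
  field. lra. }
assert (I : is_RInt (fun t => / w t) 0 (PI / 2) (elliptic (1 - e ^ 2))).
{ apply (RInt_correct (V := R_CompleteNormedModule)), ex_RInt_elliptic. lra. }
assert (cp : forall t, 0 <= t <= PI / 2 -> 0 <= cos t).
{ intros t Ht. apply cos_ge_0; lra. }
assert (sp : forall t, 0 <= t <= PI / 2 -> 0 <= sin t).
{ intros t Ht. apply sin_nonneg; lra. }
assert (J : is_RInt (fun t => sin t / w t) 0 (PI / 2) ((ln (1 + q) - ln e) / q)).
{ replace ((ln (1 + q) - ln e) / q)
    with (- ln (q * cos (PI / 2) + w (PI / 2)) / q - - ln (q * cos 0 + w 0) / q).
  - apply (is_RInt_primitive (fun t => - ln (q * cos t + w t) / q)); [lra| |].
    + intros t Ht. specialize (cp t Ht). specialize (wp t). 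
      specialize (dw t). specialize (cs t).
      assert (0 < q * cos t + w t) by nra.
      auto_derive.
      * split; [now exists (- (1 - e ^ 2) * sin t * cos t / w t)|lra].
      * change (fun x => w x) with w. rewrite (is_derive_unique _ _ _ dw).
        rewrite <- Hqq. field. lra.
    + intros t Ht. specialize (wp t). specialize (dw t). auto_derive.
      split; [|lra]. now exists (- (1 - e ^ 2) * sin t * cos t / w t).
  - rewrite cos_PI2, cos_0. 
    replace (w (PI / 2)) with e.
    2:{ unfold w. rewrite sin_PI2. replace (1 - (1 - e ^ 2) * 1 ^ 2) with (e ^ 2) by ring.
        rewrite sqrt_pow2; lra. }
    replace (w 0) with 1.
    2:{ unfold w. rewrite sin_0. replace (1 - (1 - e ^ 2) * 0 ^ 2) with 1 by ring.
        now rewrite sqrt_1. }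
    rewrite Rmult_0_r, Rplus_0_l, Rmult_1_r, (Rplus_comm q). field. lra. }
assert (Q : is_RInt (fun t => / w t - sin t / w t) 0 (PI / 2)
   (elliptic (1 - e ^ 2) - (ln (1 + q) - ln e) / q)).
{ apply (is_RInt_minus (V := R_NormedModule) _ _ _ _ _ _ I J). }
assert (M : is_RInt (fun t => cos t / (1 + sin t)) 0 (PI / 2) (ln 2)).
{ replace (ln 2) with (ln (1 + sin (PI / 2)) - ln (1 + sin 0))
    by (rewrite sin_PI2, sin_0, Rplus_0_r, ln_1, Rminus_0_r; f_equal; ring).
  apply (is_RInt_primitive (fun t => ln (1 + sin t))); [lra| |].
  - intros t Ht. specialize (sp t Ht). auto_derive; [lra|]. field. lra.
  - intros t Ht. specialize (sp t Ht). auto_derive. lra. }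
assert (M' : is_RInt (fun t => cos t / (1 + sin t) - e) 0 (PI / 2)
   (ln 2 - (PI / 2 - 0) * e)).
{ apply (is_RInt_minus (V := R_NormedModule) _ _ _ _ _ _ M
    (is_RInt_const (V := R_NormedModule) 0 (PI / 2) e)). }
assert (Qeq : forall t, 0 <= t <= PI / 2 ->
  / w t - sin t / w t = cos t * cos t / ((1 + sin t) * w t)).
{ intros t Ht. rewrite cs. specialize (wp t). specialize (sp t Ht). field. lra. }
assert (up : elliptic (1 - e ^ 2) - (ln (1 + q) - ln e) / q <= ln 2).
{ apply (RInt_mono _ _ 0 (PI / 2) _ _ ltac:(lra) Q M). intros t Ht.
  rewrite Qeq by lra. specialize (wp t). specialize (ww t). specialize (cs t).
  assert (0 <= cos t) by (apply cp; lra). assert (0 <= sin t) by (apply sp; lra).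
  assert (cos t <= w t) by (simpl in ww; nra).
  apply Rle_div_l; [apply Rmult_lt_0_compat; lra|].
  replace (cos t / (1 + sin t) * ((1 + sin t) * w t)) with (cos t * w t) by (field; lra).
  nra. }
assert (low : ln 2 - (PI / 2 - 0) * e <= elliptic (1 - e ^ 2) - (ln (1 + q) - ln e) / q).
{ apply (RInt_mono _ _ 0 (PI / 2) _ _ ltac:(lra) M' Q). intros t Ht.
  rewrite Qeq by lra. specialize (wp t). specialize (ww t). specialize (cs t).
  assert (0 <= cos t) by (apply cp; lra). assert (0 <= sin t) by (apply sp; lra).
  assert (w t <= cos t + e) by (simpl in ww; nra).
  apply Rle_trans with ((cos t - e) / (1 + sin t)).
  - apply Rminus_le_0.
    replace ((cos t - e) / (1 + sin t) - (cos t / (1 + sin t) - e))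
      with (e * sin t / (1 + sin t)) by (field; lra).
    apply Rdiv_le_0_compat; nra.
  - apply (Rle_div_r _ _ ((1 + sin t) * w t)); [apply Rmult_lt_0_compat; lra|].
    replace ((cos t - e) / (1 + sin t) * ((1 + sin t) * w t))
      with ((cos t - e) * w t) by (field; lra).
    destruct (Rle_lt_dec (cos t) e); nra. }
(* This keeps (1 / q - 1) ln e small, as 1 - q is of order e^2. *)
assert (ln_e : 0 <= - ln e * e <= 1).
{ assert (ln e <= 0) by (pose proof (ln_le_sub1 e); lra).
  pose proof (sub_inv_le_ln e ltac:(lra)). split; [nra|].
  apply Rle_trans with ((/ e - 1) * e); [nra|].
  rewrite Rmult_minus_distr_r, Rinv_l; lra. }
assert (rest : (ln (1 + q) - ln e) / q + ln e
  = ln (1 + q) / q + (- ln e * e) * (e / (q * (1 + q)))).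
{ transitivity (ln (1 + q) / q + - ln e * (1 - q * q) / (q * (1 + q))).
  - field. lra.
  - rewrite Hqq. field. lra. }
assert (0 < e / (q * (1 + q))) by (apply Rdiv_lt_0_compat; nra).
unfold L. split; nra.
Qed.

(** For terms of one sign, each partial sum is a limit of partial sums that lie
    below F, and each value F m lies below the full sum; so the Abel limit is
    the sum. *)
Lemma abel_nonneg (a : nat -> R) (F : nat -> R) (x : nat -> R) (l : R) :
  (forall k, 0 <= a (S k)) -> (forall m, 0 <= x m <= 1) -> is_lim_seq x 1 ->
  (forall m, is_series (fun k => a k * x m ^ k) (F m)) -> is_lim_seq F l ->
  is_lim_seq (sum_f_R0 a) l.
Proof.
intros Ha Hx xlim HF Flim.
assert (up : forall n, sum_f_R0 a n <= l).
{ intros n.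
  assert (H : is_lim_seq (fun m => sum_f_R0 (fun k => a k * x m ^ k) n) (sum_f_R0 a n)).
  { induction n as [|n IH]; simpl sum_f_R0.
    - apply is_lim_seq_ext with (fun _ => a 0%nat); [intros; simpl; ring|].
      apply is_lim_seq_const.
    - apply is_lim_seq_plus'; [exact IH|].
      replace (a (S n)) with (a (S n) * 1 ^ S n) by (rewrite pow1; ring).
      apply is_lim_seq_mult'; [|apply (lim_pow x 1 (S n) xlim)].
      rewrite pow1, Rmult_1_r. apply is_lim_seq_const. }
  refine (is_lim_seq_le _ _ _ _ _ H Flim). intros m.
  apply (series_partial_le (fun k => a k * x m ^ k)); [apply HF|].
  intros k. apply Rmult_le_pos; [apply Ha|apply pow_le, Hx]. }
assert (ex : ex_finite_lim_seq (sum_f_R0 a)).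
{ apply ex_finite_lim_seq_incr with l; [|exact up].
  intros n. rewrite sum_S. specialize (Ha n). lra. }
destruct ex as [E HE].
assert (E1 : E <= l) by exact (is_lim_seq_le _ _ _ _ up HE (is_lim_seq_const l)).
assert (E2 : l <= E).
{ refine (is_lim_seq_le F (fun _ => E) l E _ Flim (is_lim_seq_const E)). intros m.
  assert (Hm := HF m). apply series_limit in Hm.
  refine (is_lim_seq_le _ _ _ _ _ Hm HE). intros n.
  apply sum_Rle. intros k _. destruct k as [|k]; [simpl; lra|].
  assert (x m ^ S k <= 1) by (rewrite <- (pow1 (S k)); apply pow_incr, Hx).
  specialize (Ha k). nra. }
replace l with E by lra. exact HE.
Qed.

Lemma elliptic_limit :
  is_lim_seq (fun m => 2 * elliptic (1 - (/ INR (m + 2)) ^ 2)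
    + ln ((/ INR (m + 2)) ^ 2)) (4 * ln 2).
Proof.
set (e := fun m => / INR (m + 2)).
assert (He : forall m, 0 < e m < 1).
{ intros m. unfold e. rewrite plus_INR. simpl (INR 2). pose proof (pos_INR m).
  split; [apply Rinv_0_lt_compat; lra|].
  rewrite <- Rinv_1. apply Rinv_lt_contravar; lra. }
assert (elim : is_lim_seq e 0).
{ apply (is_lim_seq_inv (fun m => INR (m + 2)) p_infty); [|discriminate].
  apply (is_lim_seq_incr_n INR 2), is_lim_seq_INR. }
set (q := fun m => sqrt (1 - e m ^ 2)).
assert (qlim : is_lim_seq q 1).
{ replace 1 with (sqrt (1 - 0 ^ 2)) by
    (replace (1 - 0 ^ 2) with 1 by ring; apply sqrt_1).
  apply is_lim_seq_continuous; [apply continuity_pt_sqrt; simpl; lra|].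
  apply is_lim_seq_minus'; [apply is_lim_seq_const|now apply lim_pow]. }
assert (Llim : is_lim_seq (fun m => ln (1 + q m) / q m + ln 2) (2 * ln 2)).
{ replace (2 * ln 2) with (ln (1 + 1) / 1 + ln 2)
    by (replace (1 + 1) with 2 by ring; field).
  apply is_lim_seq_plus'; [|apply is_lim_seq_const].
  apply is_lim_seq_div'; [|exact qlim|lra].
  apply (is_lim_seq_continuous ln).
  - apply derivable_continuous_pt. exists (/ (1 + 1)). apply derivable_pt_lim_ln. lra.
  - apply is_lim_seq_plus'; [apply is_lim_seq_const|exact qlim]. }
apply is_lim_seq_le_le with
  (fun m => 2 * ((ln (1 + q m) / q m + ln 2) - PI / 2 * e m))
  (fun m => 2 * ((ln (1 + q m) / q m + ln 2) + e m / (q m * (1 + q m)))).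
- intros m. destruct (elliptic_asymptotic (e m) (He m)) as [H1 H2].
  fold (q m) in H1, H2. fold (e m).
  replace (ln (e m ^ 2)) with (2 * ln (e m)).
  2:{ simpl. rewrite Rmult_1_r, ln_mult; [ring| |]; apply He. }
  split; lra.
- replace (Finite (4 * ln 2)) with (Finite (2 * (2 * ln 2 - PI / 2 * 0)))
    by (f_equal; ring).
  apply is_lim_seq_mult'; [apply is_lim_seq_const|].
  apply is_lim_seq_minus'; [exact Llim|].
  apply is_lim_seq_mult'; [apply is_lim_seq_const|exact elim].
- replace (Finite (4 * ln 2)) with (Finite (2 * (2 * ln 2 + 0 / (1 * (1 + 1)))))
    by (f_equal; field).
  apply is_lim_seq_mult'; [apply is_lim_seq_const|].
  apply is_lim_seq_plus'; [exact Llim|].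
  apply is_lim_seq_div'; [exact elim| |lra].
  apply is_lim_seq_mult'; [exact qlim|].
  apply is_lim_seq_plus'; [apply is_lim_seq_const|exact qlim].
Qed.

(** The terms of the two sums have generating functions 2 K and - ln (1 - x).
    By [oddeven_ratio_sq_le] the terms of index at least 1 differ by a quantity
    of one sign, so the limit at x = 1 is the limit of the partial sums. *)
Lemma landau_harmonic_limit :
  is_lim_seq (fun n => PI * landau_G n - sum_n_m (fun k => / INR k) 1 n) (4 * ln 2).
Proof.
set (a := fun k => (if (k =? 0)%nat then 0 else / INR k) - PI * oddeven_ratio k ^ 2).
set (x := fun m => 1 - (/ INR (m + 2)) ^ 2).
assert (He : forall m, 0 < / INR (m + 2) < 1).
{ intros m. rewrite plus_INR. simpl (INR 2). pose proof (pos_INR m).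
  split; [apply Rinv_0_lt_compat; lra|].
  rewrite <- Rinv_1. apply Rinv_lt_contravar; lra. }
assert (Hx : forall m, 0 <= x m < 1).
{ intros m. specialize (He m). unfold x. simpl. nra. }
assert (H : is_lim_seq (sum_f_R0 a) (- (4 * ln 2))).
{ apply (abel_nonneg a
    (fun m => - (2 * elliptic (x m) + ln ((/ INR (m + 2)) ^ 2))) x).
  - intros k. unfold a. simpl (_ =? _)%nat. cbv iota.
    pose proof (oddeven_ratio_sq_le k). lra.
  - intros m. specialize (Hx m). lra.
  - replace (Finite 1) with (Finite (1 - 0 ^ 2)) by (f_equal; ring).
    apply is_lim_seq_minus'; [apply is_lim_seq_const|].
    apply lim_pow, (is_lim_seq_inv (fun m => INR (m + 2)) p_infty); [|discriminate].
    apply (is_lim_seq_incr_n INR 2), is_lim_seq_INR.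
  - intros m.
    assert (S1 := ln_series (x m)). rewrite Rabs_pos_eq in S1 by apply Hx.
    specialize (S1 (proj2 (Hx m))).
    assert (S2 := series_mull (-1) _ _ (elliptic_series (x m) (Hx m))).
    assert (S := series_add _ _ _ _ S1 S2).
    replace (1 - x m) with ((/ INR (m + 2)) ^ 2) in S by (unfold x; ring).
    replace (- (2 * elliptic (x m) + ln ((/ INR (m + 2)) ^ 2)))
      with (- ln ((/ INR (m + 2)) ^ 2) + -1 * (2 * elliptic (x m))) by ring.
    revert S. apply series_ext. intros k. unfold a. ring.
  - apply (is_lim_seq_opp _ (4 * ln 2)), elliptic_limit. }
apply (is_lim_seq_opp _ (- (4 * ln 2))) in H. simpl in H.
rewrite Ropp_involutive in H.
revert H. apply is_lim_seq_ext. intros n.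
unfold landau_G. rewrite sum_n_m_Reals, sum_n_Reals, <- sum_mull.
enough (sum_f_R0 a n = sum_f_R0 (fun j => match j with O => 0 | S _ => / INR j end) n
  + -1 * sum_f_R0 (fun i => PI * oddeven_ratio i ^ 2) n) by lra.
rewrite <- sum_mull, <- sum_add. apply sum_ext.
intros [|k] _; unfold a; simpl (_ =? _)%nat; cbv iota; ring.
Qed.

Lemma landau_limit :
  is_lim_seq (fun n => PI * landau_G n - ln (INR n + 3 / 4)) (euler_gamma + 4 * ln 2).
Proof.
apply (is_lim_seq_incr_1 (fun n => PI * landau_G n - ln (INR n + 3 / 4))).
assert (H1 := landau_harmonic_limit). apply is_lim_seq_incr_1 in H1.
assert (H3 : is_lim_seq (fun n => ln (1 + 3 / 4 * / INR (S n))) 0).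
{ replace (Finite 0) with (Finite (ln (1 + 3 / 4 * 0)))
    by (rewrite Rmult_0_r, Rplus_0_r, ln_1; reflexivity).
  apply (is_lim_seq_continuous ln).
  - apply derivable_continuous_pt. exists (/ (1 + 3 / 4 * 0)).
    apply derivable_pt_lim_ln. lra.
  - apply is_lim_seq_plus'; [apply is_lim_seq_const|].
    apply is_lim_seq_mult'; [apply is_lim_seq_const|].
    apply (is_lim_seq_incr_1 (fun n => / INR n) 0).
    apply (is_lim_seq_inv INR p_infty); [apply is_lim_seq_INR|discriminate]. }
assert (H := is_lim_seq_minus' _ _ _ _
  (is_lim_seq_plus' _ _ _ _ euler_gamma_limit H1) H3).
rewrite Rminus_0_r in H. revert H. apply is_lim_seq_ext. intros n. cbv beta.
assert (Sp : 0 < INR (S n)) by (apply lt_0_INR; lia).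
replace (INR (S n) + 3 / 4) with (INR (S n) * (1 + 3 / 4 * / INR (S n))) by (field; lra).
pose proof (Rinv_0_lt_compat _ Sp).
rewrite ln_mult by lra. ring.
Qed.

Theorem theorem3 (n m k : nat) (hm : (1 <= m)%nat) (hk : (1 <= k)%nat) :
  let N := INR n + 3 / 4 in
  ln N + euler_gamma + 4 * ln 2
    + sum_n_m (fun s => beta s / N ^ (2 * s)) 1 (2 * m)
  < PI * landau_G n
  /\
  PI * landau_G n
  < ln N + euler_gamma + 4 * ln 2
    + sum_n_m (fun s => beta s / N ^ (2 * s)) 1 (2 * k - 1).
Proof.
intros N.
assert (H1 := expansion_error_sign _ landau_limit (2 * m) n).
assert (H2 := expansion_error_sign _ landau_limit (2 * k - 1) n).
fold N in H1, H2. unfold expansion in H1, H2.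
rewrite pow_m1_even in H1.
replace ((-1) ^ (2 * k - 1)) with (-1) in H2.
2:{ replace (2 * k - 1)%nat with (S (2 * (k - 1))) by lia.
    rewrite <- tech_pow_Rmult, pow_m1_even. ring. }
split; lra.
Qed.
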